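(* Consider on $\mathbb{C}^2$, with coordinates $(z,w)$ and complex time $t\in\mathbb{C}$, the polynomial vector field (with real coefficients) $$\begin{cases} z' = w + z(z^2+w^2+1),\\ w' = -z + w(z^2+w^2+1),\end{cases}\qquad z'=\frac{dz}{dt},\ w'=\frac{dw}{dt},$$ and the singular holomorphic foliation of $\mathbb{C}^2$ that it defines. Then the algebraic curve $L=\{(z,w)\in\mathbb{C}^2 : z^2+w^2+1=0\}$ is a complex limit cycle of this foliation (that is, $L$ is a leaf of the foliation and there is a closed curve $\gamma$ in $L$ whose holonomy map is not the identity), and $L$ does not intersect the real plane $\mathbb{R}^2=\{(z,w)\in\mathbb{C}^2 : \Im(z)=\Im(w)=0\}$.
   Context: A polynomial vector field $z'=P(z,w)$, $w'=Q(z,w)$ on $\mathbb{C}^2$ defines a singular holomorphic foliation of $\mathbb{C}^2$ by holomorphic curves, equivalently given by $\omega=0$ with $\omega=-Q\,dz+P\,dw$. Its singular points are the common zeros of $P$ and $Q$. Away from the singular points it is a regular one-dimensional holomorphic foliation, whose leaves are the (maximal, connected) nonsingular complex integral curves of the vector field: each nonsingular point has a neighborhood $U$ and a biholomorphism $\phi:U\to V\times W\subset\mathbb{C}\times\mathbb{C}$ (a foliation chart), with $V,W$ open discs, that maps each connected component of the intersection of a leaf with $U$ to a plaque $V\times\{c\}$, $c\in W$. Holonomy: let $L$ be a leaf, $p\in L$, $\gamma$ a closed curve in $L$ based at $p$, and $S$ a one-dimensional complex local section through $p$ transversal to $L$. The holonomy map $h_\gamma$ is the germ at $p$ of the holomorphic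 map $(S,p)\to(S,p)$ obtained by following leaves through foliation charts along $\gamma$ (the complex analogue of the Poincaré return map); in particular $s$ and $h_\gamma(s)$ lie on the same leaf. It depends only on the class of $\gamma$ in $\pi_1(L,p)$. The set $G(L)=\{h_\gamma : \gamma\in\pi_1(L,p)\}$ is a group, called the monodromy group of $L$. A complex limit cycle is a leaf $L$ whose monodromy group $G(L)$ is nontrivial, i.e. a leaf containing a closed curve $\gamma$ whose holonomy map $h_\gamma$ is not (the germ of) the identity map. *)

(* Defs.v *)
(* Stdlib reals with Coquelicot's complex numbers. *)
From Stdlib Require Import Reals.
From Coquelicot Require Import Coquelicot.

Definition C2 : Type := (C * C)%type.

(* C and C^2 as complex normed spaces: [is_derive] and [ex_filterdiff] over
   [C_AbsRing] are complex derivatives and complex Frechet differentiability.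
   [AbsRing_NormedModule C_AbsRing], whose norm is [Cmod], is the structure that
   [is_derive] puts on its domain; [C_NormedModule] has the same topology but
   is not convertible to it. *)
Definition C_normed : NormedModule C_AbsRing := AbsRing_NormedModule C_AbsRing.

Definition C2_normed : NormedModule C_AbsRing :=
  prod_NormedModule C_AbsRing C_normed C_normed.

Definition is_Cderive2 (f : C -> C2) (t : C) (d : C2) : Prop :=
  @is_derive C_AbsRing C2_normed f t d.

Definition ex_Cderive (f : C -> C) (t : C) : Prop :=
  @ex_derive C_AbsRing C_normed f t.

Definition open2 (U : C2 -> Prop) : Prop := @open C2_normed U.

Definition holomorphic2 (U : C2 -> Prop) (f : C2 -> C2) : Prop :=
  forall p, U p ->
    @ex_filterdiff C_AbsRing C2_normed C2_normed f (@locally C2_normed p).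

Definition open_disc (a : C) (r : R) (t : C) : Prop := (Cmod (t - a) < r)%R.

(* The vector field z' = P(z,w), w' = Q(z,w). *)
Definition vector_field (P Q : C -> C -> C) : C2 -> C2 :=
  fun p => (P (fst p) (snd p), Q (fst p) (snd p)).

Definition nonsingular (X : C2 -> C2) (p : C2) : Prop :=
  X p <> (RtoC 0, RtoC 0).

Section Foliation.

Variable X : C2 -> C2.

(* A is a union of complex integral curves: through each of its points passes
   a local solution in complex time that stays in A.  These sets are the open
   sets of the leaf topology, for which leaves carry their intrinsic topology
   of immersed curves (finer, in general, than the one induced by C^2). *)
Definition leaf_open (A : C2 -> Prop) : Prop :=
  forall p, A p ->
    nonsingular X p /\
    exists (r : R) (alpha : C -> C2),
      (0 < r)%R /\ alpha (RtoC 0) = p /\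
      forall t, open_disc (RtoC 0) r t ->
        is_Cderive2 alpha t (X (alpha t)) /\ A (alpha t).

(* Connected (nonsingular) integral curve.  Connectedness is that of the leaf
   topology. *)
Definition integral_curve (Gam : C2 -> Prop) : Prop :=
  (exists p, Gam p) /\
  leaf_open Gam /\
  forall A B : C2 -> Prop,
    leaf_open A -> leaf_open B ->
    (forall p, Gam p <-> A p \/ B p) ->
    (exists p, A p) -> (exists p, B p) ->
    exists p, A p /\ B p.

(* K is a maximal connected integral curve inside A; when A is the
   intersection of a leaf with an open set, these K are the connected
   components of A. *)
Definition component (A K : C2 -> Prop) : Prop :=
  integral_curve K /\ (forall p, K p -> A p) /\
  forall K' : C2 -> Prop,
    integral_curve K' -> (forall p, K' p -> A p) ->
    (forall p, K p -> K' p) -> forall p, K' p -> K p.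

Definition leaf (L : C2 -> Prop) : Prop := component (nonsingular X) L.

(* Data of a map [chart_map : U -> V x W] with inverse [chart_inv], where
   U = [chart_dom] and V, W are discs; outside U, resp. V x W, the values of
   the two maps are irrelevant. *)
Record chart : Type := Chart {
  chart_dom : C2 -> Prop;
  chart_map : C2 -> C2;
  chart_inv : C2 -> C2;
  V_center : C; V_radius : R;
  W_center : C; W_radius : R }.

Definition chart_V (c : chart) : C -> Prop := open_disc (V_center c) (V_radius c).
Definition chart_W (c : chart) : C -> Prop := open_disc (W_center c) (W_radius c).
Definition chart_VW (c : chart) (q : C2) : Prop :=
  chart_V c (fst q) /\ chart_W c (snd q).

Definition biholomorphic_chart (c : chart) : Prop :=
  (0 < V_radius c)%R /\ (0 < W_radius c)%R /\
  open2 (chart_dom c) /\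
  holomorphic2 (chart_dom c) (chart_map c) /\
  holomorphic2 (chart_VW c) (chart_inv c) /\
  (forall p, chart_dom c p ->
     chart_VW c (chart_map c p) /\ chart_inv c (chart_map c p) = p) /\
  (forall q, chart_VW c q ->
     chart_dom c (chart_inv c q) /\ chart_map c (chart_inv c q) = q).

(* The image of every connected component of (leaf) /\ U is a whole plaque
   V x {b}. *)
Definition foliation_chart (c : chart) : Prop :=
  biholomorphic_chart c /\
  (forall p, chart_dom c p -> nonsingular X p) /\
  forall L K : C2 -> Prop,
    leaf L -> component (fun p => L p /\ chart_dom c p) K ->
    exists b : C, chart_W c b /\
      forall q : C2,
        (exists p, K p /\ chart_map c p = q) <-> (chart_V c (fst q) /\ snd q = b).

Definition same_plaque (c : chart) (p q : C2) : Prop :=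
  chart_dom c p /\ chart_dom c q /\
  snd (chart_map c p) = snd (chart_map c q).

(* A local section is given by a holomorphic parametrization of it by the disc
   |s| < [sec_radius]; germs of maps between sections are written in the
   parameter s. *)
Record section : Type := LocalSection {
  sec_map : C -> C2;
  sec_radius : R }.

Definition transversal_section (S : section) (p : C2) : Prop :=
  (0 < sec_radius S)%R /\
  sec_map S (RtoC 0) = p /\
  (forall s s', open_disc (RtoC 0) (sec_radius S) s ->
     open_disc (RtoC 0) (sec_radius S) s' ->
     sec_map S s = sec_map S s' -> s = s') /\
  (forall s, open_disc (RtoC 0) (sec_radius S) s ->
     exists d : C2, is_Cderive2 (sec_map S) s d /\
       (fst d * snd (X (sec_map S s)) - snd d * fst (X (sec_map S s)) <> 0)%C).

(* g is (the germ at 0 of) the map that sends a point of S to the point of T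
   near [sec_map T 0] that lies on the same plaque of the chart c. *)
Definition plaque_transport (c : chart) (S T : section) (g : C -> C) : Prop :=
  g (RtoC 0) = RtoC 0 /\
  exists e : R, (0 < e)%R /\
    forall s, open_disc (RtoC 0) e s ->
      ex_Cderive g s /\
      open_disc (RtoC 0) (sec_radius S) s /\
      open_disc (RtoC 0) (sec_radius T) (g s) /\
      same_plaque c (sec_map S s) (sec_map T (g s)).

Definition germ_eq (g h : C -> C) : Prop :=
  exists e : R, (0 < e)%R /\ forall s, open_disc (RtoC 0) e s -> g s = h s.

(* [compose_upto g n] is g_(n-1) o ... o g_0. *)
Fixpoint compose_upto (g : nat -> C -> C) (n : nat) (s : C) : C :=
  match n with
  | O => s
  | Datatypes.S m => g m (compose_upto g m s)
  end.

Definition unit_interval (t : R) : Prop := (0 <= t <= 1)%R.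

Definition closed_curve (L : C2 -> Prop) (p : C2) (gam : R -> C2) : Prop :=
  @continuous_on R_UniformSpace C2_normed unit_interval gam /\
  (forall t, unit_interval t -> L (gam t)) /\
  gam 0%R = p /\ gam 1%R = p.

(* h represents the holonomy germ of gam on the section S: subdivide [0,1] so
   that each gam([t_i, t_(i+1)]) lies in one plaque of a foliation chart c_i,
   put a transversal section T_i at each gam(t_i), with T_0 = T_n = S, and
   compose the transports T_i -> T_(i+1) along the plaques of c_i.  The
   resulting germ does not depend on these choices. *)
Definition holonomy (gam : R -> C2) (S : section) (h : C -> C) : Prop :=
  exists (n : nat) (t : nat -> R) (c : nat -> chart) (T : nat -> section)
         (g : nat -> C -> C),
    t O = 0%R /\ t n = 1%R /\ T O = S /\ T n = S /\
    (forall i, (i <= n)%nat -> transversal_section (T i) (gam (t i))) /\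
    (forall i, (i < n)%nat ->
       (t i < t (Datatypes.S i))%R /\
       foliation_chart (c i) /\
       (forall u, (t i <= u <= t (Datatypes.S i))%R ->
          same_plaque (c i) (gam (t i)) (gam u)) /\
       plaque_transport (c i) (T i) (T (Datatypes.S i)) (g i)) /\
    germ_eq h (compose_upto g n).

(* The monodromy group of L, based at p and computed on the section S, as a
   set of representatives of germs. *)
Definition monodromy (L : C2 -> Prop) (p : C2) (S : section) (h : C -> C)
  : Prop :=
  exists gam : R -> C2, closed_curve L p gam /\ holonomy gam S h.

(* Changing p and S conjugates the monodromy group, so its nontriviality does
   not depend on them. *)
Definition complex_limit_cycle (L : C2 -> Prop) : Prop :=
  leaf L /\
  exists (p : C2) (S : section) (h : C -> C),
    L p /\ transversal_section S p /\
    monodromy L p S h /\ ~ germ_eq h (fun s => s).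

End Foliation.

Definition real_plane (p : C2) : Prop := Im (fst p) = 0%R /\ Im (snd p) = 0%R.

(* Main.v *)
(** In the coordinates u = z + iw, v = z - iw the field is u' = u (f - i),
    v' = v (f + i) with f = uv + 1.  The ratio u/v is multiplied by e^(-2it)
    along the flow, so the time t is (i/2) log (u/v), and (1 + 1/(uv)) e^(2t) is
    a multivalued first integral, which vanishes exactly on the curve uv = -1.
    These two functions are flow-box coordinates near any point of that curve.
    Along the loop u = i e^(-is), v = i e^(is), 0 <= s <= 2 pi, the time grows by
    2 pi, so the holonomy is the contraction s |-> e^(-4 pi) s.  Gronwall's
    inequality gives uniqueness of complex solutions, which identifies the plaques
    of a flow box with the components of the leaves. *)
Require Import Defs.
From Stdlib Require Import Reals Lra Lia Psatz Classical ClassicalEpsilon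
  FunctionalExtensionality PropExtensionality.
From Coquelicot Require Import Coquelicot.
Open Scope R_scope.

(** * Complex derivatives, exponential and logarithm *)

(** The chart condition speaks of every leaf and of every component of its trace on the chart, so it
    cannot be checked by describing leaves. It is derived for flow boxes in general: maximality puts
    the plaque inside the component, and connectedness in the leaf topology keeps the component
    inside one plaque. Both directions rest on intersections of leaf-open sets being leaf-open,
    which is where uniqueness of solutions enters. The product [uv] obeys the Bernoulli equation
    [(uv)' = 2 uv (uv + 1)], which [y = - 1/(uv)] makes linear: [y' = 2 (1 - y)]. So [1 - y] decays
    like [e^(-2t)], the source of both the first integral and the contraction. Time is multivalued
    along the loop while only a principal logarithm is at hand. Hence the charts form a family
    indexed by a base time [theta], each a rotated copy of one chart. All sections are parametrized
    by [s = 1 - y], so every transport is multiplication by the same constant and the holonomy is a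
    power of it. *)

Notation is_Cderive f t d := (@is_derive C_AbsRing C_normed f t d).

Lemma is_derive_C_eps (f : C -> C) (t d : C) :
  is_Cderive f t d <->
  forall eps, 0 < eps -> exists delta, 0 < delta /\
    forall s, Cmod (s - t) < delta ->
      Cmod (f s - f t - (s - t) * d) <= eps * Cmod (s - t).
Proof.
split.
- intros [_ H] eps He.
  destruct (H t (fun P HP => HP) (mkposreal eps He)) as [[r Hr] Hd].
  exists r; split; [exact Hr|].
  intros s Hs; exact (Hd s Hs).
- intros H; split; [apply (@is_linear_scal_l C_AbsRing C_normed)|].
  intros x Hx.
  apply (@is_filter_lim_locally_unique C_AbsRing C_normed) in Hx; subst x.
  intros [eps He].
  destruct (H eps He) as [r [Hr Hd]].
  exists (mkposreal r Hr); intros s Hs; exact (Hd s Hs).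
Qed.

(** The Cauchy-Riemann form of the Jacobian is multiplication by [p + iq]. This reduces [Cexp] and
    [Clog] to real calculus. Each real part is taken with error [eps / 2] because passing from the
    maximum norm to [Cmod] costs [sqrt 2 <= 2]. *)
Lemma is_derive_CR (a b : R -> R -> R) (x y p q : R) :
  differentiable_pt_lim a x y p (- q) ->
  differentiable_pt_lim b x y q p ->
  is_Cderive (fun z : C => (a (fst z) (snd z), b (fst z) (snd z)) : C)
             ((x, y) : C) ((p, q) : C).
Proof.
intros Ha Hb; apply is_derive_C_eps; intros eps He.
assert (He2 : 0 < eps / 2) by lra.
destruct (Ha (mkposreal _ He2)) as [[d1 Hd1] A].
destruct (Hb (mkposreal _ He2)) as [[d2 Hd2] B].
simpl in A, B.
exists (Rmin d1 d2); split; [now apply Rmin_pos|].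
intros [u v] Hs.
pose proof (Rmax_Cmod (((u, v) : C) - ((x, y) : C))%C) as Hm.
set (m := Cmod (((u, v) : C) - ((x, y) : C))%C) in *.
simpl in Hm; fold (u - x) in Hm; fold (v - y) in Hm.
assert (M1 : Rabs (u - x) <= m) by (eapply Rle_trans; [apply Rmax_l|exact Hm]).
assert (M2 : Rabs (v - y) <= m) by (eapply Rle_trans; [apply Rmax_r|exact Hm]).
assert (m < d1) by (eapply Rlt_le_trans; [exact Hs|apply Rmin_l]).
assert (m < d2) by (eapply Rlt_le_trans; [exact Hs|apply Rmin_r]).
specialize (A u v ltac:(lra) ltac:(lra)).
specialize (B u v ltac:(lra) ltac:(lra)).
set (mm := Rmax (Rabs (u - x)) (Rabs (v - y))) in *.
eapply Rle_trans; [apply Cmod_2Rmax|].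
assert (S2 : sqrt 2 <= 2).
{ rewrite <- (sqrt_Rsqr 2) at 2 by lra. apply sqrt_le_1; unfold Rsqr; lra. }
assert (0 <= sqrt 2) by apply sqrt_pos.
apply Rle_trans with (2 * (eps / 2 * mm)); [|nra].
apply Rmult_le_compat; [assumption| |assumption|].
- eapply Rle_trans; [apply Rabs_pos|apply Rmax_l].
- apply Rmax_lub; simpl.
  + replace (a u v + - a x y + - ((u + - x) * p - (v + - y) * q))
      with (a u v - a x y - (p * (u - x) + - q * (v - y))) by ring. exact A.
  + replace (b u v + - b x y + - ((u + - x) * q + (v + - y) * p))
      with (b u v - b x y - (q * (u - x) + p * (v - y))) by ring. exact B.
Qed.

Lemma differentiable_pt_lim_fst x y : differentiable_pt_lim (fun u _ => u) x y 1 0.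
Proof.
intros eps; exists (mkposreal 1 Rlt_0_1); intros u v _ _.
replace (u - x - (1 * (u - x) + 0 * (v - y))) with 0 by ring.
rewrite Rabs_R0; apply Rmult_le_pos; [apply Rlt_le, cond_pos|].
eapply Rle_trans; [apply Rabs_pos|apply Rmax_l].
Qed.

Lemma differentiable_pt_lim_snd x y : differentiable_pt_lim (fun _ v => v) x y 0 1.
Proof.
intros eps; exists (mkposreal 1 Rlt_0_1); intros u v _ _.
replace (v - y - (0 * (u - x) + 1 * (v - y))) with 0 by ring.
rewrite Rabs_R0; apply Rmult_le_pos; [apply Rlt_le, cond_pos|].
eapply Rle_trans; [apply Rabs_pos|apply Rmax_l].
Qed.

Lemma differentiable_pt_lim_Rplus x y : differentiable_pt_lim Rplus x y 1 1.
Proof.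
intros eps; exists (mkposreal 1 Rlt_0_1); intros u v _ _.
replace (u + v - (x + y) - (1 * (u - x) + 1 * (v - y))) with 0 by ring.
rewrite Rabs_R0; apply Rmult_le_pos; [apply Rlt_le, cond_pos|].
eapply Rle_trans; [apply Rabs_pos|apply Rmax_l].
Qed.

Lemma differentiable_pt_lim_Rmult x y : differentiable_pt_lim Rmult x y y x.
Proof.
intros eps; exists eps; intros u v Hu Hv.
replace (u * v - x * y - (y * (u - x) + x * (v - y)))
  with ((u - x) * (v - y)) by ring.
rewrite Rabs_mult.
apply Rmult_le_compat; try apply Rabs_pos; [lra|apply Rmax_r].
Qed.

Lemma differentiable_pt_lim_comp1 (f : R -> R) (g : R -> R -> R) x y l gx gy :
  is_derive f (g x y) l -> differentiable_pt_lim g x y gx gy ->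
  differentiable_pt_lim (fun u v => f (g u v)) x y (l * gx) (l * gy).
Proof.
intros Hf Hg.
replace (l * gx) with (l * gx + 0 * gx) by ring.
replace (l * gy) with (l * gy + 0 * gy) by ring.
apply (differentiable_pt_lim_comp (fun u _ => f u) g g); try assumption.
apply differentiable_pt_lim_proj1_0, is_derive_Reals, Hf.
Qed.

Lemma differentiable_pt_lim_mult f g x y fx fy gx gy :
  differentiable_pt_lim f x y fx fy -> differentiable_pt_lim g x y gx gy ->
  differentiable_pt_lim (fun u v => f u v * g u v) x y
    (g x y * fx + f x y * gx) (g x y * fy + f x y * gy).
Proof.
intros Hf Hg; apply differentiable_pt_lim_comp; try assumption.
apply differentiable_pt_lim_Rmult.
Qed.

Lemma differentiable_pt_lim_plus f g x y fx fy gx gy :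
  differentiable_pt_lim f x y fx fy -> differentiable_pt_lim g x y gx gy ->
  differentiable_pt_lim (fun u v => f u v + g u v) x y (fx + gx) (fy + gy).
Proof.
intros Hf Hg.
rewrite <- (Rmult_1_l fx), <- (Rmult_1_l gx), <- (Rmult_1_l fy), <- (Rmult_1_l gy).
apply differentiable_pt_lim_comp; try assumption.
apply differentiable_pt_lim_Rplus.
Qed.

Lemma differentiable_pt_lim_eq f x y p q p' q' :
  differentiable_pt_lim f x y p q -> p = p' -> q = q' ->
  differentiable_pt_lim f x y p' q'.
Proof. now intros H <- <-. Qed.

Definition Cexp (z : C) : C :=
  (exp (fst z) * cos (snd z), exp (fst z) * sin (snd z)).

(* The principal logarithm, correct only on the half-plane [Re z > 0]. *)
Definition Clog (z : C) : C :=
  (/ 2 * ln (fst z * fst z + snd z * snd z), atan (snd z * / fst z)).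

Lemma is_derive_Cexp (z : C) : is_Cderive Cexp z (Cexp z).
Proof.
destruct z as [x y].
apply (is_derive_CR (fun x y => exp x * cos y) (fun x y => exp x * sin y)).
- eapply differentiable_pt_lim_eq.
  + apply differentiable_pt_lim_mult;
      (eapply differentiable_pt_lim_comp1;
       [first [apply is_derive_exp|apply is_derive_cos]
       |first [apply differentiable_pt_lim_fst|apply differentiable_pt_lim_snd]]).
  + simpl; ring.
  + simpl; ring.
- eapply differentiable_pt_lim_eq.
  + apply differentiable_pt_lim_mult;
      (eapply differentiable_pt_lim_comp1;
       [first [apply is_derive_exp|apply is_derive_sin]
       |first [apply differentiable_pt_lim_fst|apply differentiable_pt_lim_snd]]).
  + simpl; ring.
  + simpl; ring.
Qed.

Lemma is_derive_Clog (z : C) : 0 < Re z -> is_Cderive Clog z (/ z)%C.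
Proof.
destruct z as [x y]; unfold Re; simpl; intros Hx.
apply (is_derive_CR (fun x y => / 2 * ln (x * x + y * y))
                    (fun x y => atan (y * / x))).
- eapply differentiable_pt_lim_eq.
  + eapply (differentiable_pt_lim_comp1 (fun w => / 2 * ln w)).
    * apply (is_derive_scal ln), is_derive_ln; nra.
    * apply differentiable_pt_lim_plus; apply differentiable_pt_lim_mult;
      first [apply differentiable_pt_lim_fst|apply differentiable_pt_lim_snd].
  + simpl; field; nra.
  + simpl; field; nra.
- eapply differentiable_pt_lim_eq.
  + eapply (differentiable_pt_lim_comp1 atan).
    * apply is_derive_atan.
    * apply (differentiable_pt_lim_mult (fun _ v => v) (fun u _ => / u)).
      -- apply differentiable_pt_lim_snd.
      -- eapply (differentiable_pt_lim_comp1 Rinv (fun u _ => u)).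
         ++ apply (is_derive_inv (fun u => u) x 1); [apply (@is_derive_id R_AbsRing)|lra].
         ++ apply differentiable_pt_lim_fst.
  + simpl; unfold Rsqr; field; repeat split; nra.
  + simpl; unfold Rsqr; field; repeat split; nra.
Qed.

Lemma Cexp_plus (a b : C) : Cexp (a + b) = (Cexp a * Cexp b)%C.
Proof.
unfold Cexp; simpl; rewrite exp_plus, cos_plus, sin_plus.
unfold Cmult; simpl; f_equal; ring.
Qed.

Lemma Cexp_0 : Cexp 0 = 1%C.
Proof. unfold Cexp; simpl; rewrite exp_0, cos_0, sin_0; unfold RtoC; f_equal; ring. Qed.

Lemma Cexp_neq_0 (z : C) : Cexp z <> 0.
Proof.
intros H; apply C1_nz.
rewrite <- Cexp_0, <- (Cplus_opp_r z), Cexp_plus, H; ring.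
Qed.

Lemma Cexp_opp (z : C) : Cexp (- z) = (/ Cexp z)%C.
Proof.
rewrite <- (Cmult_1_l (/ Cexp z)), <- Cexp_0, <- (Cplus_opp_r z), Cexp_plus.
field; apply Cexp_neq_0.
Qed.

Lemma Cexp_Clog (z : C) : 0 < Re z -> Cexp (Clog z) = z.
Proof.
destruct z as [x y]; unfold Re, Cexp, Clog; simpl; intros Hx.
assert (HP : 0 < x * x + y * y) by nra.
assert (E : exp (/ 2 * ln (x * x + y * y)) = sqrt (x * x + y * y)).
{ rewrite <- Rpower_sqrt by assumption; reflexivity. }
rewrite E, cos_atan, sin_atan.
(* The half-plane hypothesis matters here: the sign of [x] decides the sign of the root. *)
assert (E2 : sqrt (1 + (y * / x)²) = sqrt (x * x + y * y) / x).
{ apply Rsqr_inj.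
  - apply sqrt_pos.
  - apply Rmult_le_pos; [apply sqrt_pos|left; now apply Rinv_0_lt_compat].
  - rewrite Rsqr_sqrt by (pose proof (Rle_0_sqr (y * / x)); lra).
    rewrite Rsqr_div', Rsqr_sqrt by lra. unfold Rsqr; field; lra. }
rewrite E2.
assert (0 < sqrt (x * x + y * y)) by (now apply sqrt_lt_R0).
f_equal; field; lra.
Qed.

Lemma Clog_Cexp (z : C) : Rabs (Im z) < PI / 2 -> Clog (Cexp z) = z.
Proof.
destruct z as [x y]; unfold Im, Clog, Cexp; simpl; intros Hy.
apply Rabs_lt_between in Hy.
assert (0 < cos y) by (apply cos_gt_0; lra).
pose proof (exp_pos x).
f_equal.
- replace (exp x * cos y * (exp x * cos y) + exp x * sin y * (exp x * sin y))
    with (exp x * exp x * ((sin y)² + (cos y)²)) by (unfold Rsqr; ring).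
  rewrite sin2_cos2, Rmult_1_r, ln_mult, ln_exp by assumption; field.
- replace (exp x * sin y * / (exp x * cos y)) with (tan y)
    by (unfold tan; field; lra).
  apply atan_tan; lra.
Qed.

Lemma Im_Clog (z : C) : Rabs (Im (Clog z)) < PI / 2.
Proof.
unfold Clog, Im; simpl; apply Rabs_lt_between.
pose proof (atan_bound (snd z * / fst z)); lra.
Qed.

Lemma Re_Cexp_pos (z : C) : Rabs (Im z) < PI / 2 -> 0 < Re (Cexp z).
Proof.
intros Hy; apply Rabs_lt_between in Hy; unfold Im in Hy.
apply Rmult_lt_0_compat; [apply exp_pos|apply cos_gt_0; lra].
Qed.

(** In the strip of half-width [PI] the cosine is positive only within [PI / 2] of the real axis.
    This serves to identify the principal logarithm of an exponential whose exponent is a sum of two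
    principal logarithms. *)
Lemma Im_lt_of_Re_Cexp_pos (z : C) :
  Rabs (Im z) < PI -> 0 < Re (Cexp z) -> Rabs (Im z) < PI / 2.
Proof.
intros Hy Hr; apply Rabs_lt_between in Hy.
unfold Cexp, Re in Hr; simpl in Hr; unfold Im in *.
pose proof (exp_pos (fst z)).
assert (Hc : 0 < cos (snd z)) by nra.
apply Rabs_lt_between.
split; apply Rnot_le_lt; intros HH.
- rewrite <- cos_neg in Hc.
  pose proof (cos_le_0 (- snd z)); lra.
- pose proof (cos_le_0 (snd z)); lra.
Qed.

(** One of the rotations by [1], [-1], [i], [-i] moves [z] into the right half-plane, where [Clog]
    is available; each of these rotations is itself an exponential. *)
Lemma Cexp_surj (z : C) : z <> 0 -> exists c, Cexp c = z.
Proof.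
intros Hz.
assert (K : forall k c : C, Cexp c = k -> 0 < Re (k * z)%C -> exists c', Cexp c' = z).
{ intros k c Hk Hr; exists (Clog (k * z) + - c)%C.
  rewrite Cexp_plus, Cexp_opp, Cexp_Clog, Hk by assumption.
  field; rewrite <- Hk; apply Cexp_neq_0. }
destruct z as [x y].
destruct (Rtotal_order x 0) as [H|[H|H]].
- apply (K (- (1))%C (0, PI)).
  + unfold Cexp, Copp, RtoC; simpl; rewrite exp_0, cos_PI, sin_PI; f_equal; ring.
  + unfold Re; simpl; lra.
- subst x; destruct (Rtotal_order y 0) as [H|[H|H]].
  + apply (K Ci (0, PI/2)).
    * unfold Cexp, Ci; simpl; rewrite exp_0, cos_PI2, sin_PI2; f_equal; ring.
    * unfold Re; simpl; lra.
  + subst; now destruct Hz.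
  + apply (K (- Ci)%C (0, - (PI/2))).
    * unfold Cexp, Ci, Copp; simpl; rewrite exp_0, cos_neg, sin_neg, cos_PI2, sin_PI2.
      f_equal; ring.
    * unfold Re; simpl; lra.
- apply (K 1%C 0%C); [apply Cexp_0|unfold Re; simpl; lra].
Qed.

(** * Calculus rules for complex derivatives into C and C^2 *)

Lemma is_Cderive_val (f : C -> C) (t d d' : C) :
  is_Cderive f t d -> d = d' -> is_Cderive f t d'.
Proof. now intros H <-. Qed.

Lemma is_Cderive_plus (f g : C -> C) (t df dg : C) :
  is_Cderive f t df -> is_Cderive g t dg ->
  is_Cderive (fun s => f s + g s)%C t (df + dg)%C.
Proof. exact (@is_derive_plus C_AbsRing C_normed f g t df dg). Qed.

Lemma is_Cderive_minus (f g : C -> C) (t df dg : C) :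
  is_Cderive f t df -> is_Cderive g t dg ->
  is_Cderive (fun s => f s - g s)%C t (df - dg)%C.
Proof. exact (@is_derive_minus C_AbsRing C_normed f g t df dg). Qed.

Lemma is_Cderive_opp (f : C -> C) (t d : C) :
  is_Cderive f t d -> is_Cderive (fun s => - f s)%C t (- d)%C.
Proof. exact (@is_derive_opp C_AbsRing C_normed f t d). Qed.

Lemma is_Cderive_mult (f g : C -> C) (t df dg : C) :
  is_Cderive f t df -> is_Cderive g t dg ->
  is_Cderive (fun s => f s * g s)%C t (df * g t + f t * dg)%C.
Proof.
intros Hf Hg.
exact (@is_derive_mult C_AbsRing f g t df dg Hf Hg Cmult_comm).
Qed.

Lemma is_Cderive_const (a t : C) : is_Cderive (fun _ => a) t (RtoC 0).
Proof. exact (@is_derive_const C_AbsRing C_normed a t). Qed.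

Lemma is_Cderive_id (t : C) : is_Cderive (fun s => s) t (RtoC 1).
Proof. exact (@is_derive_id C_AbsRing t). Qed.

Lemma is_Cderive_comp (f g : C -> C) (t df dg : C) :
  is_Cderive f (g t) df -> is_Cderive g t dg ->
  is_Cderive (fun s => f (g s)) t (dg * df)%C.
Proof. exact (@is_derive_comp C_AbsRing C_normed f g t df dg). Qed.

Lemma is_Cderive_scal_l (k : C) (f : C -> C) (t d : C) :
  is_Cderive f t d -> is_Cderive (fun s => k * f s)%C t (k * d)%C.
Proof.
intros H; eapply is_Cderive_val.
- apply (is_Cderive_mult (fun _ => k)); [apply is_Cderive_const|exact H].
- ring.
Qed.

(** Pairing, as a function on the product, is the identity, so this is an instance of the chain rule
    with two inner functions. *)
Lemma filterdiff_pair {K : AbsRing} {T U V : NormedModule K}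
    (f lf : T -> U) (g lg : T -> V) (x : T) :
  filterdiff f (locally x) lf -> filterdiff g (locally x) lg ->
  filterdiff (V := prod_NormedModule K U V) (fun t => (f t, g t)) (locally x)
    (fun t => (lf t, lg t)).
Proof.
intros Hf Hg.
apply (filterdiff_comp'_2 (W := prod_NormedModule K U V) f g (fun u v => (u, v)) x
         lf lg (fun u v => (u, v)) Hf Hg).
apply filterdiff_ext with (fun t => t); [now intros []|].
apply filterdiff_ext_lin with (fun t => t); [|now intros []].
apply filterdiff_id.
Qed.

Lemma is_Cderive2_pair (f g : C -> C) (t df dg : C) :
  is_Cderive f t df -> is_Cderive g t dg ->
  is_Cderive2 (fun s => (f s, g s)) t (df, dg).
Proof. exact (@filterdiff_pair C_AbsRing C_normed C_normed C_normed f _ g _ t). Qed.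

Lemma is_Cderive2_fst (f : C -> C2) (t : C) (d : C2) :
  is_Cderive2 f t d -> is_Cderive (fun s => fst (f s)) t (fst d).
Proof.
intros H.
apply (@filterdiff_comp' C_AbsRing C_normed C2_normed C_normed f (fun q : C2 => fst q)
         t _ (fun q : C2 => fst q) H).
apply (@filterdiff_linear C_AbsRing C2_normed C_normed _ (fun q : C2 => fst q)).
exact (@is_linear_fst C_AbsRing C_normed C_normed).
Qed.

Lemma is_Cderive2_snd (f : C -> C2) (t : C) (d : C2) :
  is_Cderive2 f t d -> is_Cderive (fun s => snd (f s)) t (snd d).
Proof.
intros H.
apply (@filterdiff_comp' C_AbsRing C_normed C2_normed C_normed f (fun q : C2 => snd q)
         t _ (fun q : C2 => snd q) H).
apply (@filterdiff_linear C_AbsRing C2_normed C_normed _ (fun q : C2 => snd q)).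
exact (@is_linear_snd C_AbsRing C_normed C_normed).
Qed.

Lemma is_Cderive2_shift (f : C -> C2) (a t : C) (d : C2) :
  is_Cderive2 f (a + t)%C d -> is_Cderive2 (fun s => f (a + s)%C) t d.
Proof.
intros H.
assert (S : is_Cderive (fun s => a + s)%C t (RtoC 1)).
{ eapply is_Cderive_val; [apply is_Cderive_plus;
    [apply is_Cderive_const|apply is_Cderive_id]|ring]. }
destruct d as [d1 d2].
pose proof (is_Cderive_comp _ _ _ _ _ (is_Cderive2_fst _ _ _ H) S) as H1.
pose proof (is_Cderive_comp _ _ _ _ _ (is_Cderive2_snd _ _ _ H) S) as H2.
simpl in H1, H2; rewrite Cmult_1_l in H1; rewrite Cmult_1_l in H2.
apply (@is_derive_ext C_AbsRing C2_normed
         (fun s => (fst (f (a + s)%C), snd (f (a + s)%C)))).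
- intros s; symmetry; apply surjective_pairing.
- now apply is_Cderive2_pair.
Qed.

Lemma is_Cderive_continuous_eps (f : C -> C) (t d : C) (eps : R) :
  is_Cderive f t d -> 0 < eps ->
  exists delta, 0 < delta /\
    forall s, Cmod (s - t) < delta -> Cmod (f s - f t) < eps.
Proof.
intros H He.
destruct (proj1 (is_derive_C_eps f t d) H 1 Rlt_0_1) as [r [Hr Hd]].
pose proof (Cmod_ge_0 d).
set (k := 1 + Cmod d).
assert (Hk : 0 < eps / k) by (apply Rdiv_lt_0_compat; unfold k; lra).
exists (Rmin r (eps / k)); split; [now apply Rmin_pos|].
intros s Hs.
specialize (Hd s (Rlt_le_trans _ _ _ Hs (Rmin_l _ _))).
assert (Hs2 := Rlt_le_trans _ _ _ Hs (Rmin_r _ _)).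
replace (f s - f t)%C with ((f s - f t - (s - t) * d) + (s - t) * d)%C by ring.
eapply Rle_lt_trans; [apply Cmod_triangle|].
rewrite Cmod_mult.
apply Rle_lt_trans with (Cmod (s - t) * k); [unfold k; lra|].
apply Rlt_le_trans with (eps / k * k); [apply Rmult_lt_compat_r; unfold k in *; lra|].
unfold Rdiv; rewrite Rmult_assoc, Rinv_l, Rmult_1_r; unfold k; lra.
Qed.

Lemma is_Cderive2_continuous_eps (f : C -> C2) (t : C) (d : C2) (eps : R) :
  is_Cderive2 f t d -> 0 < eps ->
  exists delta, 0 < delta /\
    forall s, Cmod (s - t) < delta ->
      Cmod (fst (f s) - fst (f t)) < eps /\ Cmod (snd (f s) - snd (f t)) < eps.
Proof.
intros H He.
destruct (is_Cderive_continuous_eps _ _ _ _ (is_Cderive2_fst _ _ _ H) He)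
  as [r1 [H1 D1]].
destruct (is_Cderive_continuous_eps _ _ _ _ (is_Cderive2_snd _ _ _ H) He)
  as [r2 [H2 D2]].
exists (Rmin r1 r2); split; [now apply Rmin_pos|].
intros s Hs; split; [apply D1|apply D2]; eapply Rlt_le_trans;
  try exact Hs; [apply Rmin_l|apply Rmin_r].
Qed.

(** * Gronwall's inequality and uniqueness of complex solutions *)

Lemma is_derive_R_eps (f : R -> R) (t d : R) :
  (forall eps, 0 < eps -> exists delta, 0 < delta /\
    forall s, Rabs (s - t) < delta ->
      Rabs (f s - f t - (s - t) * d) <= eps * Rabs (s - t)) ->
  is_derive f t d.
Proof.
intros H; split; [apply (@is_linear_scal_l R_AbsRing R_NormedModule)|].
intros x Hx.
apply (@is_filter_lim_locally_unique R_AbsRing R_NormedModule) in Hx; subst x.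
intros [eps He].
destruct (H eps He) as [r [Hr Hd]].
exists (mkposreal r Hr); intros s Hs; exact (Hd s Hs).
Qed.

Lemma im_le_Cmod (c : C) : Rabs (Im c) <= Cmod c.
Proof. eapply Rle_trans; [apply Rmax_r|apply Rmax_Cmod]. Qed.

(** Restriction to the real ray through [t0] turns complex solutions into functions of a real
    variable, to which the mean value theorem applies. *)
Lemma is_Cderive_ray (f : C -> C) (t0 d : C) (x : R) :
  is_Cderive f (x * t0)%C d ->
  is_derive (fun x : R => Re (f (x * t0)%C)) x (Re (t0 * d)%C) /\
  is_derive (fun x : R => Im (f (x * t0)%C)) x (Im (t0 * d)%C).
Proof.
intros H.
assert (K : forall eps, 0 < eps -> exists delta, 0 < delta /\
    forall s, Rabs (s - x) < delta ->
      Cmod (f (s * t0)%C - f (x * t0)%C - (s - x)%R * (t0 * d)) <= eps * Rabs (s - x)).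
{ intros eps He.
  pose proof (Cmod_ge_0 t0) as T0.
  (* The summand 1 keeps the divisor positive when [t0 = 0]. *)
  set (k := 1 + Cmod t0).
  assert (Hk : 0 < eps / k) by (apply Rdiv_lt_0_compat; unfold k; lra).
  destruct (proj1 (is_derive_C_eps f _ d) H (eps / k) Hk) as [r [Hr Hd]].
  exists (r / k); split; [apply Rdiv_lt_0_compat; unfold k; lra|].
  intros s Hs.
  assert (E : (s * t0 - x * t0)%C = ((s - x)%R * t0)%C)
    by (rewrite RtoC_minus; ring).
  assert (EM : Cmod (s * t0 - x * t0) = Rabs (s - x) * Cmod t0)
    by (rewrite E, Cmod_mult, Cmod_R; reflexivity).
  pose proof (Rabs_pos (s - x)).
  assert (L : Cmod (s * t0 - x * t0) < r).
  { rewrite EM. apply Rle_lt_trans with (Rabs (s - x) * k); [unfold k; nra|].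
    apply Rlt_le_trans with (r / k * k); [apply Rmult_lt_compat_r; unfold k in *; lra|].
    unfold Rdiv; rewrite Rmult_assoc, Rinv_l, Rmult_1_r; unfold k; lra. }
  specialize (Hd _ L).
  rewrite E, <- Cmult_assoc in Hd.
  eapply Rle_trans; [exact Hd|].
  rewrite <- E, EM.
  replace (eps / k * (Rabs (s - x) * Cmod t0))
    with (eps * Rabs (s - x) * (Cmod t0 / k)) by (unfold Rdiv; ring).
  rewrite <- (Rmult_1_r (eps * Rabs (s - x))) at 2.
  apply Rmult_le_compat_l; [nra|].
  apply Rle_div_l; unfold k; lra. }
split; apply is_derive_R_eps; intros eps He;
  destruct (K eps He) as [r [Hr Hd]]; exists r; (split; [exact Hr|]);
  intros s Hs; eapply Rle_trans; try exact (Hd s Hs).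
- eapply Rle_trans; [|apply re_le_Cmod]; right; f_equal.
  rewrite <- re_scal_l; unfold Cminus; rewrite !re_plus, !re_opp; ring.
- eapply Rle_trans; [|apply im_le_Cmod]; right; f_equal.
  rewrite <- im_scal_l; unfold Cminus; rewrite !im_plus, !im_opp; ring.
Qed.

(** The function [N x * exp (- K * x)] has nonpositive derivative and vanishes at 0. *)
Lemma gronwall_zero (N N' : R -> R) (K : R) :
  (forall x, 0 <= x <= 1 -> is_derive N x (N' x) /\ N' x <= K * N x) ->
  N 0 = 0 -> N 1 <= 0.
Proof.
intros H H0.
assert (D : forall x, 0 <= x <= 1 ->
  is_derive (fun x => N x * exp (- K * x)) x ((N' x - K * N x) * exp (- K * x))).
{ intros x Hx; destruct (H x Hx) as [Hd _].
  evar_last.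
  - apply (Derive.is_derive_mult N (fun x => exp (- K * x))); [exact Hd|].
    auto_derive; [trivial|reflexivity].
  - simpl; ring. }
destruct (MVT_gen (fun x => N x * exp (- K * x)) 0 1
            (fun x => (N' x - K * N x) * exp (- K * x))) as [c [Hc E]].
- rewrite Rmin_left, Rmax_right by lra; intros; apply D; lra.
- rewrite Rmin_left, Rmax_right by lra; intros x Hx.
  apply continuity_pt_filterlim.
  apply (@ex_derive_continuous R_AbsRing R_NormedModule
           (fun x => N x * exp (- K * x))).
  eexists; apply D; lra.
- rewrite Rmin_left, Rmax_right in Hc by lra.
  rewrite H0 in E.
  destruct (H c Hc) as [_ Hle].
  pose proof (exp_pos (- K * c)); pose proof (exp_pos (- K * 1)).
  assert ((N' c - K * N c) * exp (- K * c) <= 0) by nra.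
  apply Rnot_lt_le; intros Hn; nra.
Qed.

(** Cauchy-Schwarz in the real plane: the left side is the real part of [conj a * b]. *)
Lemma Re_dot_le (a b : C) : Re a * Re b + Im a * Im b <= Cmod a * Cmod b.
Proof.
rewrite <- (Cmod_conj a), <- Cmod_mult.
eapply Rle_trans; [|apply re_le_Cmod].
eapply Rle_trans; [|apply Rle_abs].
rewrite re_mult, re_conj, im_conj; lra.
Qed.

Definition near2 (r : R) (p q : C2) : Prop :=
  Cmod (fst q - fst p) < r /\ Cmod (snd q - snd p) < r.

Definition locally_Lipschitz (X : C2 -> C2) : Prop :=
  forall p, exists r M, 0 < r /\ 0 <= M /\
    forall q q', near2 r p q -> near2 r p q' ->
      let l := M * (Cmod (fst q - fst q') + Cmod (snd q - snd q')) in
      Cmod (fst (X q) - fst (X q')) <= l /\ Cmod (snd (X q) - snd (X q')) <= l.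

Definition solution_on (X : C2 -> C2) (D : C -> Prop) (alpha : C -> C2) : Prop :=
  forall t, D t -> is_Cderive2 alpha t (X (alpha t)).

(* Gronwall for the squared distance of the two solutions along the ray from 0 to t. *)
Lemma solution_unique (X : C2 -> C2) (alpha beta : C -> C2) (r : R) :
  locally_Lipschitz X -> 0 < r ->
  solution_on X (open_disc 0 r) alpha -> solution_on X (open_disc 0 r) beta ->
  alpha 0 = beta 0 ->
  exists delta, 0 < delta <= r /\ forall t, open_disc 0 delta t -> alpha t = beta t.
Proof.
intros HL Hr Ha Hb E0.
destruct (HL (alpha 0)) as [rho [M [Hrho [HM HX]]]].
assert (Z : open_disc 0 r 0).
{ unfold open_disc; replace (0 - 0)%C with (RtoC 0) by ring; now rewrite Cmod_0. }
destruct (is_Cderive2_continuous_eps _ _ _ rho (Ha _ Z) Hrho) as [d1 [Hd1 C1]].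
destruct (is_Cderive2_continuous_eps _ _ _ rho (Hb _ Z) Hrho) as [d2 [Hd2 C2]].
exists (Rmin r (Rmin d1 d2)); split.
{ split; [repeat apply Rmin_pos; assumption|apply Rmin_l]. }
intros t Ht.
assert (Hx : forall x : R, 0 <= x <= 1 ->
  open_disc 0 r (x * t) /\ near2 rho (alpha 0) (alpha (x * t)%C)
  /\ near2 rho (alpha 0) (beta (x * t)%C)).
{ intros x Hx.
  assert (Hs : Cmod (x * t - 0) < Rmin r (Rmin d1 d2)).
  { eapply Rle_lt_trans; [|exact Ht].
    replace (x * t - 0)%C with (x * (t - 0))%C by ring.
    rewrite Cmod_mult, Cmod_R, Rabs_pos_eq by lra.
    pose proof (Cmod_ge_0 (t - 0)); nra. }
  split; [eapply Rlt_le_trans; [exact Hs|apply Rmin_l]|].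
  split; [apply C1|rewrite E0; apply C2]; (eapply Rlt_le_trans; [exact Hs|]);
    (eapply Rle_trans; [apply Rmin_r|]); [apply Rmin_l|apply Rmin_r]. }
set (dz := fun x : R => (fst (alpha (x * t)%C) - fst (beta (x * t)%C))%C).
set (dw := fun x : R => (snd (alpha (x * t)%C) - snd (beta (x * t)%C))%C).
set (ez := fun x : R => (fst (X (alpha (x * t)%C)) - fst (X (beta (x * t)%C)))%C).
set (ew := fun x : R => (snd (X (alpha (x * t)%C)) - snd (X (beta (x * t)%C)))%C).
set (N := fun x : R => Re (dz x) * Re (dz x) + Im (dz x) * Im (dz x)
                     + (Re (dw x) * Re (dw x) + Im (dw x) * Im (dw x))).
set (N' := fun x : R => 2 * (Re (dz x) * Re (t * ez x)%C + Im (dz x) * Im (t * ez x)%C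
             + (Re (dw x) * Re (t * ew x)%C + Im (dw x) * Im (t * ew x)%C))).
assert (NE : forall x, N x = Cmod (dz x) ^ 2 + Cmod (dw x) ^ 2)
  by (intros x; unfold N; rewrite !Cmod2_alt; ring).
assert (N1 : N 1 <= 0).
(* With [a], [b] the moduli of the two coordinate differences, Cauchy-Schwarz and the Lipschitz
   bound give [N' <= 2 |t| M (a + b)^2], and [(a + b)^2 <= 2 (a^2 + b^2)] yields the constant
   [4 |t| M]. *)
{ apply gronwall_zero with N' (4 * Cmod t * M).
  - intros x Hx01; destruct (Hx x Hx01) as [Hd [Na Nb]].
    split.
    + assert (Dz := is_Cderive_minus _ _ _ _ _ (is_Cderive2_fst _ _ _ (Ha _ Hd))
                    (is_Cderive2_fst _ _ _ (Hb _ Hd))).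
      assert (Dw := is_Cderive_minus _ _ _ _ _ (is_Cderive2_snd _ _ _ (Ha _ Hd))
                    (is_Cderive2_snd _ _ _ (Hb _ Hd))).
      destruct (is_Cderive_ray _ _ _ _ Dz) as [Rz Iz].
      destruct (is_Cderive_ray _ _ _ _ Dw) as [Rw Iw].
      evar_last.
      * apply (@is_derive_plus R_AbsRing R_NormedModule);
          apply (@is_derive_plus R_AbsRing R_NormedModule);
          apply Derive.is_derive_mult;
          first [exact Rz|exact Iz|exact Rw|exact Iw].
      * unfold N', dz, dw, ez, ew, plus; simpl; ring.
    + destruct (HX _ _ Na Nb) as [L1 L2].
      fold (dz x) (dw x) (ez x) in L1; fold (dz x) (dw x) (ew x) in L2.
      rewrite NE; unfold N'.
      pose proof (Re_dot_le (dz x) (t * ez x)) as P1.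
      pose proof (Re_dot_le (dw x) (t * ew x)) as P2.
      rewrite Cmod_mult in P1, P2.
      pose proof (Cmod_ge_0 t); pose proof (Cmod_ge_0 (dz x)); pose proof (Cmod_ge_0 (dw x)).
      set (a := Cmod (dz x)) in *; set (b := Cmod (dw x)) in *; set (T := Cmod t) in *.
      assert (Q1 : a * (T * Cmod (ez x)) <= a * (T * (M * (a + b)))).
      { apply Rmult_le_compat_l, Rmult_le_compat_l; assumption. }
      assert (Q2 : b * (T * Cmod (ew x)) <= b * (T * (M * (a + b)))).
      { apply Rmult_le_compat_l, Rmult_le_compat_l; assumption. }
      assert (Q3 : 0 <= T * M * (a - b) ^ 2).
      { apply Rmult_le_pos; [now apply Rmult_le_pos|apply pow2_ge_0]. }
      nra.
  - rewrite NE; unfold dz, dw.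
    replace (0 * t)%C with (RtoC 0) by ring.
    rewrite E0; unfold Cminus; rewrite !Cplus_opp_r, Cmod_0; ring. }
rewrite NE in N1.
assert (Zz : Cmod (dz 1) = 0).
{ pose proof (Cmod_ge_0 (dz 1)); pose proof (Cmod_ge_0 (dw 1)); nra. }
assert (Zw : Cmod (dw 1) = 0).
{ pose proof (Cmod_ge_0 (dz 1)); pose proof (Cmod_ge_0 (dw 1)); nra. }
apply Cmod_eq_0 in Zz; apply Cmod_eq_0 in Zw.
unfold dz in Zz; unfold dw in Zw; rewrite Cmult_1_l in Zz, Zw.
rewrite (surjective_pairing (alpha t)), (surjective_pairing (beta t)).
f_equal; now apply Ceq_minus.
Qed.

(** * Leaf topology and flow boxes *)

Lemma open_disc_center (a : C) (r : R) : 0 < r -> open_disc a r a.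
Proof.
intros Hr; unfold open_disc.
replace (a - a)%C with (RtoC 0) by ring; now rewrite Cmod_0.
Qed.

Lemma open_disc_open (a : C) (r : R) (t : C) : open_disc a r t ->
  exists e, 0 < e /\ forall s, open_disc t e s -> open_disc a r s.
Proof.
unfold open_disc; intros Ht; exists (r - Cmod (t - a)); split; [lra|].
intros s Hs; replace (s - a)%C with ((s - t) + (t - a))%C by ring.
eapply Rle_lt_trans; [apply Cmod_triangle|lra].
Qed.

Lemma open_disc_convex (a : C) (r : R) (t s : C) (x : R) :
  open_disc a r t -> open_disc a r s -> 0 <= x <= 1 ->
  open_disc a r (t + x * (s - t))%C.
Proof.
unfold open_disc; intros Ht Hs Hx.
replace (t + x * (s - t) - a)%C with ((1 - x)%R * (t - a) + x * (s - a))%C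
  by (rewrite RtoC_minus; ring).
eapply Rle_lt_trans; [apply Cmod_triangle|].
rewrite !Cmod_mult, !Cmod_R, !Rabs_pos_eq by lra.
pose proof (Cmod_ge_0 (t - a)); pose proof (Cmod_ge_0 (s - a)).
destruct (Req_dec x 0) as [->|Hn]; nra.
Qed.

Lemma open_disc_shift (t s : C) (e : R) :
  open_disc 0 e s -> open_disc t e (t + s)%C.
Proof.
unfold open_disc; intros H.
now replace (t + s - t)%C with (s - 0)%C by ring.
Qed.

Lemma solution_on_shift (X : C2 -> C2) (D : C -> Prop) (phi : C -> C2) (t : C) (e : R) :
  solution_on X D phi -> (forall s, open_disc t e s -> D s) ->
  solution_on X (open_disc 0 e) (fun s => phi (t + s)%C).
Proof.
intros Hs HD s Hse; apply is_Cderive2_shift, Hs, HD.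
now apply open_disc_shift.
Qed.

Section LeafTopology.

Variable X : C2 -> C2.
Hypothesis X_Lip : locally_Lipschitz X.

(* A leaf-open set contains a piece of every solution through each of its
   points, not just of the solution that witnesses leaf-openness. *)
Lemma leaf_open_solution (A : C2 -> Prop) (phi : C -> C2) (t : C) (r : R) :
  leaf_open X A -> 0 < r -> solution_on X (open_disc t r) phi -> A (phi t) ->
  exists delta, 0 < delta <= r /\ forall s, open_disc t delta s -> A (phi s).
Proof.
intros HA Hr Hphi Hp.
destruct (HA _ Hp) as [_ [r' [alpha [Hr' [Ha0 Ha]]]]].
assert (Hm : 0 < Rmin r r') by now apply Rmin_pos.
destruct (solution_unique X (fun s => phi (t + s)%C) alpha (Rmin r r') X_Lip Hm)
  as [d [Hd Hu]].
- apply (solution_on_shift X (open_disc t r)); [exact Hphi|].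
  intros s Hs; eapply Rlt_le_trans; [exact Hs|apply Rmin_l].
- intros s Hs; apply Ha; eapply Rlt_le_trans; [exact Hs|apply Rmin_r].
- rewrite Ha0; f_equal; ring.
- exists d; split; [split; [lra|eapply Rle_trans; [apply Hd|apply Rmin_l]]|].
  intros s Hs.
  assert (Hs' : open_disc 0 d (s - t)).
  { unfold open_disc in *; now replace (s - t - 0)%C with (s - t)%C by ring. }
  assert (E := Hu _ Hs').
  simpl in E; replace (t + (s - t))%C with s in E by ring; rewrite E.
  apply Ha.
  eapply Rlt_le_trans; [exact Hs'|].
  eapply Rle_trans; [apply Hd|apply Rmin_r].
Qed.

(** The solutions witnessing that [A] and [B] are leaf-open may be different functions; by
    uniqueness the one staying in [A] also stays in [B] for small time. *)
Lemma leaf_open_inter (A B : C2 -> Prop) :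
  leaf_open X A -> leaf_open X B -> leaf_open X (fun p => A p /\ B p).
Proof.
intros HA HB p [HpA HpB].
destruct (HA p HpA) as [Hns [r [alpha [Hr [Ha0 Ha]]]]].
split; [exact Hns|].
destruct (leaf_open_solution B alpha 0 r HB Hr) as [d [Hd HdB]].
- intros t Ht; now apply Ha.
- now rewrite Ha0.
- exists d, alpha; split; [lra|split; [exact Ha0|]].
  intros t Ht.
  destruct (Ha t) as [H1 H2]; [eapply Rlt_le_trans; [exact Ht|apply Hd]|].
  split; [exact H1|split; [exact H2|now apply HdB]].
Qed.

Lemma leaf_open_union (A B : C2 -> Prop) :
  leaf_open X A -> leaf_open X B -> leaf_open X (fun p => A p \/ B p).
Proof.
intros HA HB p [Hp|Hp]; [destruct (HA p Hp) as [Hn [r [al [Hr [H0 H]]]]]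
                        |destruct (HB p Hp) as [Hn [r [al [Hr [H0 H]]]]]];
  (split; [exact Hn|]; exists r, al; split; [exact Hr|split; [exact H0|]]);
  intros t Ht; destruct (H t Ht); split; tauto.
Qed.

(** Connectedness of [K] applied to the traces of [A] and [B] on [K]. In this form [A] and [B] may
    be larger than [K], as they are in the uses below. *)
Lemma integral_curve_inside (K A B : C2 -> Prop) (p : C2) :
  integral_curve X K -> leaf_open X A -> leaf_open X B ->
  (forall q, K q -> A q \/ B q) -> (forall q, A q -> B q -> False) ->
  K p -> A p -> forall q, K q -> A q.
Proof.
intros [_ [HK Hc]] HA HB Hcov Hdis HpK HpA q Hq.
destruct (Hcov q Hq) as [H|H]; [exact H|exfalso].
destruct (Hc (fun p => K p /\ A p) (fun p => K p /\ B p)) as [x [[_ Hx1] [_ Hx2]]].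
- now apply leaf_open_inter.
- now apply leaf_open_inter.
- intros x; split; [|tauto].
  intros Hx; destruct (Hcov x Hx); tauto.
- now exists p.
- now exists q.
- now apply (Hdis x).
Qed.

(** In a disjoint splitting, the side that contains the common point [p] contains both curves, which
    leaves the other side empty. *)
Lemma integral_curve_union (K1 K2 : C2 -> Prop) (p : C2) :
  integral_curve X K1 -> integral_curve X K2 -> K1 p -> K2 p ->
  integral_curve X (fun q => K1 q \/ K2 q).
Proof.
intros H1 H2 Hp1 Hp2; split; [exists p; now left|split].
- apply leaf_open_union; [apply H1|apply H2].
- intros A B HA HB Hcov [a Ha] [b Hb]; apply NNPP; intros Hn.
  assert (Hdis : forall q, A q -> B q -> False) by (intros q Hq Hq'; apply Hn; now exists q).
  assert (Hdis' : forall q, B q -> A q -> False) by (intros q Hq Hq'; now apply (Hdis q)).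
  assert (C1 : forall q, K1 q -> A q \/ B q) by (intros q Hq; apply Hcov; now left).
  assert (C2 : forall q, K2 q -> A q \/ B q) by (intros q Hq; apply Hcov; now right).
  assert (C1' : forall q, K1 q -> B q \/ A q) by (intros q Hq; destruct (C1 q Hq); tauto).
  assert (C2' : forall q, K2 q -> B q \/ A q) by (intros q Hq; destruct (C2 q Hq); tauto).
  destruct (C1 p Hp1) as [Hp|Hp].
  + pose proof (integral_curve_inside K1 A B p H1 HA HB C1 Hdis Hp1 Hp b).
    pose proof (integral_curve_inside K2 A B p H2 HA HB C2 Hdis Hp2 Hp b).
    apply (Hdis b); [|exact Hb].
    destruct (proj2 (Hcov b) (or_intror Hb)); tauto.
  + pose proof (integral_curve_inside K1 B A p H1 HB HA C1' Hdis' Hp1 Hp a).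
    pose proof (integral_curve_inside K2 B A p H2 HB HA C2' Hdis' Hp2 Hp a).
    apply (Hdis a); [exact Ha|].
    destruct (proj2 (Hcov a) (or_introl Ha)); tauto.
Qed.

Definition convex (D : C -> Prop) : Prop :=
  forall t s (x : R), D t -> D s -> 0 <= x <= 1 -> D (t + x * (s - t))%C.

Definition openC (D : C -> Prop) : Prop :=
  forall t, D t -> exists e, 0 < e /\ forall s, open_disc t e s -> D s.

(* If the image were the disjoint union of A and B, the indicator function of
   A along a segment of D would be locally constant, hence constant. *)
Lemma integral_curve_image (D : C -> Prop) (phi : C -> C2) :
  openC D -> convex D -> (exists t, D t) -> solution_on X D phi ->
  (forall t, D t -> nonsingular X (phi t)) ->
  integral_curve X (fun p => exists t, D t /\ phi t = p).
Proof.
intros HO HC [t0 Ht0] HS HN; split; [now exists (phi t0), t0|split].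
- intros p [t [Ht <-]]; split; [now apply HN|].
  destruct (HO t Ht) as [e [He HeD]].
  exists e, (fun s => phi (t + s)%C); split; [exact He|split; [f_equal; ring|]].
  intros s Hs; split.
  + now apply (solution_on_shift X D phi t e HS HeD).
  + exists (t + s)%C; split; [now apply HeD, open_disc_shift|reflexivity].
- intros A B HA HB Hcov [a Ha] [b Hb]; apply NNPP; intros Hn.
  assert (Hdis : forall q, B q -> ~ A q) by (intros q Hq Hq'; apply Hn; now exists q).
  destruct (proj2 (Hcov a) (or_introl Ha)) as [ta [Hta <-]].
  destruct (proj2 (Hcov b) (or_intror Hb)) as [tb [Htb <-]].
  set (l := fun x : R => (ta + x * (tb - ta))%C).
  set (g := fun x : R => if excluded_middle_informative (A (phi (l x))) then 1 else 0).
  assert (E : g 0 = g 1).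
  { apply (@eq_is_derive R_NormedModule); [|lra].
    intros x Hx.
    assert (HD : D (l x)) by (now apply HC).
    destruct (HO _ HD) as [e [He HeD]].
    assert (HSx : solution_on X (open_disc (l x) e) phi)
      by (intros s Hs; now apply HS, HeD).
    (* Non-membership in [A] is as stable as membership: a point outside [A] lies in [B], which is
       leaf-open and disjoint from [A]. *)
    assert (Loc : exists d, 0 < d /\ forall s, open_disc (l x) d s ->
              (A (phi s) <-> A (phi (l x)))).
    { destruct (proj1 (Hcov (phi (l x))) (ex_intro _ _ (conj HD eq_refl))) as [H|H].
      - destruct (leaf_open_solution A phi (l x) e HA He HSx H) as [d [Hd HdA]].
        exists d; split; [apply Hd|]; intros s Hs; split; auto.
      - destruct (leaf_open_solution B phi (l x) e HB He HSx H) as [d [Hd HdB]].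
        exists d; split; [apply Hd|]; intros s Hs; split; intros HH; exfalso.
        + exact (Hdis _ (HdB s Hs) HH).
        + exact (Hdis _ H HH). }
    destruct Loc as [d [Hd Hl]].
    pose proof (Cmod_ge_0 (tb - ta)) as Hk.
    set (k := 1 + Cmod (tb - ta)).
    assert (Hdk : 0 < d / k) by (apply Rdiv_lt_0_compat; unfold k; lra).
    apply is_derive_ext_loc with (fun _ => g x).
    - exists (mkposreal _ Hdk); intros y Hy.
      assert (Hy' : Rabs (y - x) < d / k) by exact Hy.
      assert (HH : A (phi (l y)) <-> A (phi (l x))).
      { apply Hl; unfold open_disc, l.
        replace (ta + y * (tb - ta) - (ta + x * (tb - ta)))%C with ((y - x)%R * (tb - ta))%C
          by (rewrite RtoC_minus; ring).
        rewrite Cmod_mult, Cmod_R.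
        pose proof (Rabs_pos (y - x)).
        apply Rle_lt_trans with (Rabs (y - x) * k); [unfold k; nra|].
        apply Rlt_le_trans with (d / k * k);
          [apply Rmult_lt_compat_r; unfold k in *; lra|].
        unfold Rdiv; rewrite Rmult_assoc, Rinv_l, Rmult_1_r; unfold k; lra. }
      unfold g; do 2 destruct (excluded_middle_informative _); tauto.
    - apply (@is_derive_const R_AbsRing R_NormedModule). }
  unfold g in E.
  assert (L0 : l 0 = ta) by (unfold l; ring).
  assert (L1 : l 1 = tb) by (unfold l; ring).
  rewrite L0, L1 in E.
  destruct (excluded_middle_informative (A (phi ta))); [|tauto].
  destruct (excluded_middle_informative (A (phi tb))); [|lra].
  exact (Hdis _ Hb a0).
Qed.

(* A flow box: the first coordinate of the chart is the time. *)
Lemma foliation_chart_flow_box (c : chart) :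
  biholomorphic_chart c -> (forall p, chart_dom c p -> nonsingular X p) ->
  (forall b, chart_W c b -> solution_on X (chart_V c) (fun t => chart_inv c (t, b))) ->
  foliation_chart X c.
Proof.
intros Hc HN HS; split; [exact Hc|split; [exact HN|]].
destruct Hc as [HV [HW [_ [_ [_ [Hmap Hinv]]]]]].
intros L K HL HK.
destruct HK as [HKc [HKA HKmax]].
destruct (proj1 HKc) as [p0 Hp0].
destruct (HKA p0 Hp0) as [HLp0 HUp0].
destruct (Hmap p0 HUp0) as [HVW0 Hinv0].
set (b := snd (chart_map c p0)).
set (t0 := fst (chart_map c p0)).
assert (Ht0 : chart_V c t0) by apply HVW0.
assert (Hb : chart_W c b) by apply HVW0.
exists b; split; [exact Hb|].
assert (HP : integral_curve X (fun p => exists t, chart_V c t /\ chart_inv c (t, b) = p)).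
{ apply (integral_curve_image (chart_V c) (fun t => chart_inv c (t, b))).
  - intros t Ht; now apply open_disc_open.
  - intros t s x Ht Hs Hx; now apply open_disc_convex.
  - now exists t0.
  - now apply HS.
  - intros t Ht; apply HN, Hinv; now split. }
set (Pi := fun p => exists t, chart_V c t /\ chart_inv c (t, b) = p) in HP.
assert (HPp0 : Pi p0).
{ exists t0; split; [exact Ht0|].
  unfold t0, b; now rewrite <- surjective_pairing. }
assert (HPU : forall p, Pi p -> chart_dom c p).
{ intros p [t [Ht <-]]; apply Hinv; now split. }
(* The plaque [Pi] meets [L] at [p0], so adjoining it gives an integral curve, and maximality of the
   leaf absorbs it. The same argument then applies to the component [K]. *)
assert (HPL : forall p, Pi p -> L p).
{ destruct HL as [HLc [HLN HLmax]]; intros p Hp.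
  apply (HLmax (fun q => L q \/ Pi q)).
  - now apply (integral_curve_union L Pi p0).
  - intros q [Hq|Hq]; [now apply HLN|now apply HN, HPU].
  - now left.
  - now right. }
assert (HPK : forall p, Pi p -> K p).
{ intros p Hp; apply (HKmax (fun q => K q \/ Pi q)).
  - now apply (integral_curve_union K Pi p0).
  - intros q [Hq|Hq]; [now apply HKA|split; [now apply HPL|now apply HPU]].
  - now left.
  - now right. }
(* Motion along a solution does not change the second chart coordinate, so [Q] may be any set at
   all, with no openness asked of it. It is used below for the singleton of [b] and for its
   complement, which confines [K] to one plaque. *)
assert (Hlevel : forall Q : C -> Prop,
  leaf_open X (fun p => K p /\ Q (snd (chart_map c p)))).
{ intros Q p [HpK HpQ].
  destruct (HKA p HpK) as [HpL HpU].
  destruct (Hmap p HpU) as [[HpV HpW] HpI].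
  set (t := fst (chart_map c p)) in *; set (b' := snd (chart_map c p)) in *.
  assert (Hp : chart_inv c (t, b') = p)
    by (unfold t, b'; rewrite <- surjective_pairing; exact HpI).
  split; [now apply HN|].
  destruct (open_disc_open _ _ _ HpV) as [e [He HeV]].
  destruct (leaf_open_solution K (fun t => chart_inv c (t, b')) t e) as [d [Hd HdK]].
  - apply HKc.
  - exact He.
  - intros s Hs; apply (HS b' HpW), HeV, Hs.
  - simpl; now rewrite Hp.
  - exists d, (fun s => chart_inv c ((t + s)%C, b')).
    assert (HdV : forall s, open_disc t d s -> chart_V c s).
    { intros s Hs; apply HeV; eapply Rlt_le_trans; [exact Hs|apply Hd]. }
    split; [apply Hd|split].
    + rewrite <- Hp; do 2 f_equal; ring.
    + intros s Hs; split.
      * apply (solution_on_shift X (chart_V c) (fun t => chart_inv c (t, b')) t d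
                 (HS b' HpW) HdV s Hs).
      * split; [apply HdK, open_disc_shift, Hs|].
        rewrite (proj2 (Hinv ((t + s)%C, b') (conj (HdV _ (open_disc_shift t s d Hs)) HpW))).
        exact HpQ. }
assert (HKb : forall p, K p -> snd (chart_map c p) = b).
{ intros p Hp.
  apply (integral_curve_inside K (fun p => K p /\ snd (chart_map c p) = b)
           (fun p => K p /\ snd (chart_map c p) <> b) p0 HKc
           (Hlevel (fun x => x = b)) (Hlevel (fun x => x <> b))); try assumption.
  - intros q Hq; destruct (classic (snd (chart_map c q) = b)); tauto.
  - tauto.
  - now split. }
intros q; split.
- intros [p [Hp <-]]; split; [apply Hmap, HKA, Hp|now apply HKb].
- intros [Hq1 Hq2].
  destruct (Hinv q) as [_ HI]; [split; [exact Hq1|rewrite Hq2; exact Hb]|].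
  exists (chart_inv c q); split; [|exact HI].
  apply HPK; exists (fst q); split; [exact Hq1|].
  now rewrite <- Hq2, <- surjective_pairing.
Qed.

(** A larger integral curve [K] would split into [L] and [K] minus [L]. The latter is leaf-open
    because solutions are continuous and [L] is closed in C^2, so connectedness of [K] rules it
    out. *)
Lemma leaf_of_closed_integral_curve (L : C2 -> Prop) :
  integral_curve X L ->
  (forall p, ~ L p -> exists r, 0 < r /\ forall q, near2 r p q -> ~ L q) ->
  leaf X L.
Proof.
intros HL Hcl; split; [exact HL|split].
- intros p Hp; apply (proj1 (proj2 HL) p Hp).
- intros K HK HKN HLK p Hp; apply NNPP; intros HnL.
  destruct (proj1 HL) as [p0 Hp0].
  assert (HO : leaf_open X (fun q => K q /\ ~ L q)).
  { intros q [HqK HqL].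
    destruct (proj1 (proj2 HK) q HqK) as [Hn [r [al [Hr [H0 H]]]]].
    split; [exact Hn|].
    destruct (Hcl q HqL) as [e [He HeL]].
    destruct (is_Cderive2_continuous_eps al 0 _ e (proj1 (H _ (open_disc_center 0 r Hr))) He)
      as [d [Hd Hcont]].
    exists (Rmin r d), al; split; [now apply Rmin_pos|split; [exact H0|]].
    intros t Ht.
    assert (Ht1 : open_disc 0 r t) by (eapply Rlt_le_trans; [exact Ht|apply Rmin_l]).
    assert (Ht2 : open_disc 0 d t) by (eapply Rlt_le_trans; [exact Ht|apply Rmin_r]).
    split; [now apply H|split; [now apply H|]].
    apply HeL; rewrite <- H0; now apply Hcont. }
  apply HnL.
  apply (integral_curve_inside K L (fun q => K q /\ ~ L q) p0 HK (proj1 (proj2 HL)) HO);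
    try assumption.
  + intros q Hq; destruct (classic (L q)); tauto.
  + tauto.
  + now apply HLK.
Qed.

End LeafTopology.

(** * Holomorphic functions of two variables *)

Notation holomorphic_at f p :=
  (@ex_filterdiff C_AbsRing C2_normed C_normed f (@locally C2_normed p)).

Lemma holomorphic_at_fst (p : C2) : holomorphic_at (fun q : C2 => fst q) p.
Proof.
apply (@ex_filterdiff_linear C_AbsRing C2_normed C_normed).
exact (@is_linear_fst C_AbsRing C_normed C_normed).
Qed.

Lemma holomorphic_at_snd (p : C2) : holomorphic_at (fun q : C2 => snd q) p.
Proof.
apply (@ex_filterdiff_linear C_AbsRing C2_normed C_normed).
exact (@is_linear_snd C_AbsRing C_normed C_normed).
Qed.

Lemma holomorphic_at_const (a : C) (p : C2) : holomorphic_at (fun _ : C2 => a) p.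
Proof. apply (@ex_filterdiff_const C_AbsRing C2_normed C_normed); apply filter_filter. Qed.

Lemma holomorphic_at_plus (f g : C2 -> C) (p : C2) :
  holomorphic_at f p -> holomorphic_at g p -> holomorphic_at (fun q => f q + g q)%C p.
Proof.
exact (@ex_filterdiff_plus_fct C_AbsRing C2_normed C_normed _ (@filter_filter _ _ (@locally_filter C2_normed p)) f g).
Qed.

Lemma holomorphic_at_minus (f g : C2 -> C) (p : C2) :
  holomorphic_at f p -> holomorphic_at g p -> holomorphic_at (fun q => f q - g q)%C p.
Proof.
exact (@ex_filterdiff_minus_fct C_AbsRing C2_normed C_normed _ (@filter_filter _ _ (@locally_filter C2_normed p)) f g).
Qed.

Lemma holomorphic_at_mult (f g : C2 -> C) (p : C2) :
  holomorphic_at f p -> holomorphic_at g p -> holomorphic_at (fun q => f q * g q)%C p.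
Proof. exact (@ex_filterdiff_mult_fct C_AbsRing C2_normed f g p Cmult_comm). Qed.

Lemma holomorphic_at_scal_l (k : C) (f : C2 -> C) (p : C2) :
  holomorphic_at f p -> holomorphic_at (fun q => k * f q)%C p.
Proof. apply (holomorphic_at_mult (fun _ => k)), holomorphic_at_const. Qed.

Lemma holomorphic_at_comp (g : C -> C) (f : C2 -> C) (p : C2) (d : C) :
  is_Cderive g (f p) d -> holomorphic_at f p -> holomorphic_at (fun q => g (f q)) p.
Proof.
intros Hg Hf.
apply (@ex_filterdiff_comp' C_AbsRing C2_normed C_normed C_normed f g p Hf).
eexists; exact Hg.
Qed.

Lemma holomorphic_at_pair (f g : C2 -> C) (p : C2) :
  holomorphic_at f p -> holomorphic_at g p ->
  @ex_filterdiff C_AbsRing C2_normed C2_normed (fun q => (f q, g q)) (@locally C2_normed p).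
Proof.
intros [lf Hf] [lg Hg]; eexists.
exact (@filterdiff_pair C_AbsRing C2_normed C_normed C_normed f lf g lg p Hf Hg).
Qed.

Lemma holomorphic_at_near (f : C2 -> C) (p : C2) (eps : R) :
  holomorphic_at f p -> 0 < eps ->
  @locally C2_normed p (fun q => Cmod (f q - f p) < eps).
Proof.
intros H He.
apply (@filterdiff_continuous C_AbsRing C2_normed C_normed f p H
         (fun y : C => Cmod (y - f p) < eps)).
now exists (mkposreal eps He).
Qed.

Lemma locally_Re_pos (f : C2 -> C) (p : C2) :
  holomorphic_at f p -> 0 < Re (f p) -> @locally C2_normed p (fun q => 0 < Re (f q)).
Proof.
intros H Hp.
eapply filter_imp; [|exact (holomorphic_at_near f p _ H Hp)].
intros q Hq.
assert (HR := Rle_lt_trans _ _ _ (re_le_Cmod _) Hq).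
unfold Cminus in HR; rewrite re_plus, re_opp in HR.
apply Rabs_lt_between in HR; lra.
Qed.

Lemma locally_open_disc (f : C2 -> C) (p : C2) (a : C) (r : R) :
  holomorphic_at f p -> open_disc a r (f p) ->
  @locally C2_normed p (fun q => open_disc a r (f q)).
Proof.
intros H Hp.
destruct (open_disc_open _ _ _ Hp) as [e [He HD]].
eapply filter_imp; [|exact (holomorphic_at_near f p e H He)].
intros q Hq; now apply HD.
Qed.

Lemma Cmod_Cexp (z : C) : Cmod (Cexp z) = exp (Re z).
Proof.
assert (E : Cmod (Cexp z) ^ 2 = exp (Re z) ^ 2).
{ rewrite Cmod2_alt; unfold Cexp, Re, Im; simpl.
  pose proof (sin2_cos2 (snd z)) as S; unfold Rsqr in S.
  transitivity (exp (fst z) * exp (fst z) *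
    (sin (snd z) * sin (snd z) + cos (snd z) * cos (snd z))); [ring|].
  rewrite S; ring. }
rewrite <- (sqrt_pow2 (Cmod (Cexp z))) by apply Cmod_ge_0.
rewrite E; apply sqrt_pow2, Rlt_le, exp_pos.
Qed.

Lemma Ceq_dest (a b : C) : fst a = fst b -> snd a = snd b -> a = b.
Proof. destruct a, b; simpl; now intros -> ->. Qed.

Lemma Ci2 : (Ci * Ci = - (1))%C.
Proof. apply Ceq_dest; simpl; ring. Qed.

(** * The limit cycle and its holonomy *)

Definition limit_field : C2 -> C2 :=
  vector_field (fun z w : C => w + z * (z ^ 2 + w ^ 2 + 1))%C
               (fun z w : C => - z + w * (z ^ 2 + w ^ 2 + 1))%C.

Definition limit_curve (p : C2) : Prop := (fst p ^ 2 + snd p ^ 2 + 1)%C = RtoC 0.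

(* The coordinates z + iw and z - iw diagonalize the linear part of the field. *)
Definition coord_u (p : C2) : C := (fst p + Ci * snd p)%C.
Definition coord_v (p : C2) : C := (fst p - Ci * snd p)%C.

Definition of_uv (u v : C) : C2 :=
  (RtoC (/ 2) * (u + v), RtoC (/ 2) * (- Ci * (u - v)))%C.

Lemma half_half : (RtoC (/ 2) + RtoC (/ 2) = 1)%C.
Proof. rewrite <- RtoC_plus; f_equal; field. Qed.

Lemma coord_u_of_uv (u v : C) : coord_u (of_uv u v) = u.
Proof. unfold coord_u, of_uv; apply Ceq_dest; simpl; field. Qed.

Lemma coord_v_of_uv (u v : C) : coord_v (of_uv u v) = v.
Proof. unfold coord_v, of_uv; apply Ceq_dest; simpl; field. Qed.

Lemma of_uv_coords (p : C2) : of_uv (coord_u p) (coord_v p) = p.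
Proof. destruct p as [z w]; unfold coord_u, coord_v, of_uv; f_equal; apply Ceq_dest; simpl; field. Qed.

Lemma coord_u_v (p : C2) : (coord_u p * coord_v p = fst p ^ 2 + snd p ^ 2)%C.
Proof. unfold coord_u, coord_v; simpl Cpow; ring [Ci2]. Qed.

(** In the diagonal coordinates a zero of the field satisfies [u (f - i) = 0] and [v (f + i) = 0];
    with [u] and [v] nonzero, [f] would equal both [i] and [-i]. *)
Lemma limit_field_nonsingular (p : C2) :
  coord_u p <> 0 -> coord_v p <> 0 -> nonsingular limit_field p.
Proof.
intros Hu Hv E.
unfold limit_field, vector_field in E.
rewrite <- coord_u_v in E.
set (f := (coord_u p * coord_v p + 1)%C) in *.
assert (Ez : (snd p + fst p * f = 0)%C) by exact (f_equal fst E).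
assert (Ew : (- fst p + snd p * f = 0)%C) by exact (f_equal snd E).
assert (Eu : (coord_u p * (f - Ci) = 0)%C).
{ transitivity ((snd p + fst p * f) + Ci * (- fst p + snd p * f))%C.
  - unfold coord_u; ring [Ci2].
  - rewrite Ez, Ew; ring. }
assert (Ev : (coord_v p * (f + Ci) = 0)%C).
{ transitivity ((snd p + fst p * f) - Ci * (- fst p + snd p * f))%C.
  - unfold coord_v; ring [Ci2].
  - rewrite Ez, Ew; ring. }
destruct (Ceq_dec (f - Ci) 0) as [F1|F1]; [|now apply (Cmult_neq_0 _ _ Hu F1)].
destruct (Ceq_dec (f + Ci) 0) as [F2|F2]; [|now apply (Cmult_neq_0 _ _ Hv F2)].
assert (F : ((f + Ci) - (f - Ci) = 2 * Ci)%C) by ring.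
rewrite F1, F2 in F.
apply (f_equal snd) in F; simpl in F; lra.
Qed.

(** On the unit polydisc around [p] both coordinates are bounded by [B]. Each component difference
    is written as a combination of [z1 - z2] and [w1 - w2], whose coefficients are at most
    [1 + 2 B^2] (from [f]) plus [2 B^2]. *)
Lemma limit_field_locally_Lipschitz : locally_Lipschitz limit_field.
Proof.
intros p.
set (B := 1 + Cmod (fst p) + Cmod (snd p)).
exists 1, (1 + 4 * (B * B)); split; [lra|].
pose proof (Cmod_ge_0 (fst p)); pose proof (Cmod_ge_0 (snd p)).
split; [nra|].
assert (HB : forall q, near2 1 p q -> Cmod (fst q) <= B /\ Cmod (snd q) <= B).
{ intros q [Hz Hw]; unfold B; split.
  - replace (fst q) with ((fst q - fst p) + fst p)%C by ring.
    eapply Rle_trans; [apply Cmod_triangle|lra].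
  - replace (snd q) with ((snd q - snd p) + snd p)%C by ring.
    eapply Rle_trans; [apply Cmod_triangle|lra]. }
intros [z1 w1] [z2 w2] H1 H2.
destruct (HB _ H1) as [Z1 W1]; destruct (HB _ H2) as [Z2 W2]; simpl in Z1, W1, Z2, W2.
unfold limit_field, vector_field; simpl fst; simpl snd; simpl Cpow.
assert (P : forall x y, Cmod x <= B -> Cmod y <= B -> Cmod (x * y) <= B * B).
{ intros x y Hx Hy; rewrite Cmod_mult.
  apply Rmult_le_compat; try assumption; apply Cmod_ge_0. }
assert (T : forall x y, Cmod (x + y) <= Cmod x + Cmod y) by (intros; apply Cmod_triangle).
set (f := (z1 * (z1 * 1) + w1 * (w1 * 1) + 1)%C).
assert (Hf : Cmod f <= 1 + 2 * (B * B)).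
{ unfold f; rewrite !Cmult_1_r.
  pose proof (T (z1 * z1 + w1 * w1)%C 1%C); pose proof (T (z1 * z1) (w1 * w1))%C.
  pose proof (P z1 z1 Z1 Z1); pose proof (P w1 w1 W1 W1).
  rewrite Cmod_1 in *; lra. }
assert (Q : forall x y y', Cmod x <= B -> Cmod y <= B -> Cmod y' <= B ->
   Cmod (x * (y + y')) <= 2 * (B * B)).
{ intros x y y' Hx Hy Hy'; rewrite Cmult_plus_distr_l.
  pose proof (T (x * y) (x * y'))%C; pose proof (P x y Hx Hy); pose proof (P x y' Hx Hy'); lra. }
assert (Lin : forall a b dz dw : C, Cmod a <= 1 + 4 * (B * B) -> Cmod b <= 1 + 4 * (B * B) ->
   Cmod (a * dz + b * dw) <= (1 + 4 * (B * B)) * (Cmod dz + Cmod dw)).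
{ intros a b dz dw Ha Hb; eapply Rle_trans; [apply T|]; rewrite !Cmod_mult.
  pose proof (Cmod_ge_0 dz); pose proof (Cmod_ge_0 dw); nra. }
assert (0 <= B * B) by nra.
split.
- match goal with |- Cmod ?x <= _ =>
    replace x with ((f + z2 * (z1 + z2)) * (z1 - z2) + (1 + z2 * (w1 + w2)) * (w1 - w2))%C
      by (unfold f; ring) end.
  apply Lin; (eapply Rle_trans; [apply T|]).
  + pose proof (Q z2 z1 z2 Z2 Z1 Z2); lra.
  + pose proof (Q z2 w1 w2 Z2 W1 W2); rewrite Cmod_1; lra.
- match goal with |- Cmod ?x <= _ =>
    replace x with ((- (1) + w2 * (z1 + z2)) * (z1 - z2) + (f + w2 * (w1 + w2)) * (w1 - w2))%C
      by (unfold f; ring) end.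
  apply Lin; (eapply Rle_trans; [apply T|]).
  + pose proof (Q w2 z1 z2 W2 Z1 Z2); rewrite Cmod_m1; lra.
  + pose proof (Q w2 w1 w2 W2 W1 W2); lra.
Qed.

(** * Coordinates adapted to the flow, and the flow-box charts *)

Definition log_u (y t : C) : C := (RtoC (- / 2) * Clog y - Ci * t)%C.
Definition log_v (y t : C) : C := (RtoC (- / 2) * Clog y + Ci * t)%C.

(* [polar y t] is (R cos t, - R sin t) with R = i / sqrt y; the field is
   t' = 1, y' = 2 (1 - y) in these coordinates, and y = 1 on the limit curve. *)
Definition polar (y t : C) : C2 :=
  of_uv (Ci * Cexp (log_u y t)) (Ci * Cexp (log_v y t))%C.

Lemma coord_u_polar (y t : C) : coord_u (polar y t) = (Ci * Cexp (log_u y t))%C.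
Proof. apply coord_u_of_uv. Qed.

Lemma coord_v_polar (y t : C) : coord_v (polar y t) = (Ci * Cexp (log_v y t))%C.
Proof. apply coord_v_of_uv. Qed.

Lemma log_u_plus_log_v (y t : C) : (log_u y t + log_v y t = - Clog y)%C.
Proof.
unfold log_u, log_v; rewrite RtoC_opp.
transitivity (- ((RtoC (/2) + RtoC (/2)) * Clog y))%C; [ring|].
rewrite half_half; ring.
Qed.

Lemma coord_u_v_polar (y t : C) : 0 < Re y -> (coord_u (polar y t) * coord_v (polar y t) = - / y)%C.
Proof.
intros Hy; rewrite coord_u_polar, coord_v_polar.
transitivity ((Ci * Ci) * (Cexp (log_u y t) * Cexp (log_v y t)))%C; [ring|].
rewrite <- Cexp_plus, log_u_plus_log_v, Cexp_opp, Cexp_Clog, Ci2 by assumption; ring.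
Qed.

Lemma polar_nonsingular (y t : C) : nonsingular limit_field (polar y t).
Proof.
apply limit_field_nonsingular; rewrite ?coord_u_polar, ?coord_v_polar;
  apply Cmult_neq_0; first [apply Ci_nz|apply Cexp_neq_0].
Qed.

Lemma neq_0_of_Re_pos (y : C) : 0 < Re y -> y <> 0.
Proof. intros H ->; unfold Re in H; simpl in H; lra. Qed.

(** A change of [y] scales the point, with [c] the logarithmic derivative of [1 / sqrt y]; a change
    of [t] rotates it in the direction [(w, - z)]. Both functions are left free so that the lemma
    covers solutions as well as transversal sections, where [t] is constant. *)
Lemma is_derive_polar (y t : C -> C) (s y' t' : C) :
  is_Cderive y s y' -> is_Cderive t s t' -> 0 < Re (y s) ->
  let p := polar (y s) (t s) in
  let c := (RtoC (- / 2) * (y' / y s))%C in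
  is_Cderive2 (fun s => polar (y s) (t s)) s
    (c * fst p + t' * snd p, c * snd p - t' * fst p)%C.
Proof.
intros Hy Ht Hr p c.
assert (HL : is_Cderive (fun s => RtoC (- / 2) * Clog (y s))%C s c).
{ eapply is_Cderive_val.
  - apply is_Cderive_scal_l, (is_Cderive_comp Clog y); [apply is_derive_Clog, Hr|exact Hy].
  - reflexivity. }
assert (HI : is_Cderive (fun s => Ci * t s)%C s (Ci * t')%C) by now apply is_Cderive_scal_l.
assert (Hu : is_Cderive (fun s => Ci * Cexp (log_u (y s) (t s)))%C s
                        (coord_u p * (c - Ci * t'))%C).
{ eapply is_Cderive_val.
  - apply is_Cderive_scal_l, (is_Cderive_comp Cexp); [apply is_derive_Cexp|].
    exact (is_Cderive_minus _ _ _ _ _ HL HI).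
  - unfold p; rewrite coord_u_polar; ring. }
assert (Hv : is_Cderive (fun s => Ci * Cexp (log_v (y s) (t s)))%C s
                        (coord_v p * (c + Ci * t'))%C).
{ eapply is_Cderive_val.
  - apply is_Cderive_scal_l, (is_Cderive_comp Cexp); [apply is_derive_Cexp|].
    exact (is_Cderive_plus _ _ _ _ _ HL HI).
  - unfold p; rewrite coord_v_polar; ring. }
unfold polar at 1, of_uv.
clearbody p; apply is_Cderive2_pair.
- eapply is_Cderive_val;
    [apply is_Cderive_scal_l, is_Cderive_plus; [exact Hu|exact Hv]|].
  transitivity ((RtoC (/2) + RtoC (/2)) * (c * fst p + t' * snd p))%C;
    [unfold coord_u, coord_v; ring [Ci2]|rewrite half_half; ring].
- eapply is_Cderive_val;
    [apply is_Cderive_scal_l, is_Cderive_scal_l, is_Cderive_minus; [exact Hu|exact Hv]|].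
  transitivity ((RtoC (/2) + RtoC (/2)) * (c * snd p - t' * fst p))%C;
    [unfold coord_u, coord_v; ring [Ci2]|rewrite half_half; ring].
Qed.

(** The field is [f] times the position plus the rotation [(w, - z)], and on the image of [polar]
    the factor [f = uv + 1] equals [1 - 1/y], which is [- y' / (2 y)] for this [y']. *)
Lemma solution_polar (y t : C -> C) (s : C) :
  is_Cderive y s (2 * (1 - y s))%C -> is_Cderive t s (RtoC 1) -> 0 < Re (y s) ->
  is_Cderive2 (fun s => polar (y s) (t s)) s (limit_field (polar (y s) (t s))).
Proof.
intros Hy Ht Hr.
pose proof (is_derive_polar y t s _ _ Hy Ht Hr) as H; cbv zeta in H.
unfold limit_field, vector_field.
rewrite <- coord_u_v, coord_u_v_polar by assumption.
replace (- / y s + 1)%C with (RtoC (- / 2) * (2 * (1 - y s) / y s))%C.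
- refine (eq_ind _ (is_Cderive2 _ s) H _ _); f_equal; ring.
- rewrite RtoC_opp, RtoC_inv by lra.
  field; now apply neq_0_of_Re_pos.
Qed.

(** Division by [i] and rotation by the base time: [polar 1 theta] is sent to [u = v = 1], well
    inside the half-plane where [Clog] is correct. *)
Definition box_u (theta : C) (p : C2) : C := (- Ci * Cexp (Ci * theta) * coord_u p)%C.
Definition box_v (theta : C) (p : C2) : C := (- Ci * Cexp (- (Ci * theta)) * coord_v p)%C.

(* Time, measured from [theta], and the first integral (1 + 1/(uv)) e^(2t),
   where u = z + iw and v = z - iw. *)
Definition box_map (theta : C) (p : C2) : C2 :=
  let a := Clog (box_u theta p) in
  let b := Clog (box_v theta p) in
  (RtoC (/ 2) * (Ci * (a - b)), (1 - Cexp (- (a + b))) * Cexp (Ci * (a - b)))%C.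

(** The first integral [H = (1 - y) e^(2t)] solved for [y], with [q = (t, H)]. *)
Definition box_y (q : C2) : C := (1 - snd q * Cexp (- (2 * fst q)))%C.

Definition box_inv (theta : C) (q : C2) : C2 := polar (box_y q) (fst q + theta)%C.

(** The radius [/ 2] keeps the imaginary parts of [log_u] and [log_v] below
    [PI / 4 + 1 / 2 < PI / 2], so that [Clog] inverts [Cexp] there. The radius [exp (- 2)] forces
    [|H e^(-2t)| < 1], hence [Re y > 0]. *)
Definition in_box (q : C2) : Prop :=
  open_disc 0 (/ 2) (fst q) /\ open_disc 0 (exp (- 2)) (snd q).

(** The half-plane conditions cannot be dropped: off the imaginary axis [Clog] takes equal values at
    opposite points, so [-p] would have the same box coordinates as [p]. *)
Definition box_dom (theta : C) (p : C2) : Prop :=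
  (0 < Re (box_u theta p) /\ 0 < Re (box_v theta p)) /\ in_box (box_map theta p).

Definition box_chart (theta : C) : chart :=
  Chart (box_dom theta) (box_map theta) (box_inv theta) 0 (/ 2) 0 (exp (- 2)).

Lemma open_disc_0 (r : R) (t : C) : open_disc 0 r t -> Cmod t < r.
Proof. unfold open_disc; now replace (t - 0)%C with t by ring. Qed.

Lemma Re_box_y (q : C2) : in_box q -> 0 < Re (box_y q).
Proof.
intros [Ht HH]; apply open_disc_0 in Ht; apply open_disc_0 in HH.
unfold box_y, Cminus; rewrite re_plus, re_opp, re_RtoC.
set (x := (snd q * Cexp (- (2 * fst q)))%C).
assert (Hx : Cmod x < 1).
{ unfold x; rewrite Cmod_mult, Cmod_Cexp, re_opp, re_scal_l.
  pose proof (re_le_Cmod (fst q)) as R1.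
  assert (R2 : Rabs (Re (fst q)) < / 2) by lra.
  apply Rabs_lt_between in R2.
  apply Rle_lt_trans with (Cmod (snd q) * exp 2).
  - apply Rmult_le_compat_l; [apply Cmod_ge_0|].
    left; apply exp_increasing; lra.
  - rewrite <- exp_0; replace 0 with (- 2 + 2) by ring; rewrite exp_plus.
    apply Rmult_lt_compat_r; [apply exp_pos|assumption]. }
pose proof (re_le_Cmod x); pose proof (Rle_abs (Re x)); lra.
Qed.

Lemma Im_log_u (y t : C) : Cmod t < / 2 ->
  Rabs (Im (log_u y t)) < PI / 2 /\ Rabs (Im (log_v y t)) < PI / 2.
Proof.
intros Ht.
pose proof (Im_Clog y) as Hy.
pose proof (re_le_Cmod t) as Hr.
assert (Hr' : Rabs (Re t) < / 2) by lra.
pose proof PI2_1.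
apply Rabs_lt_between in Hr'; apply Rabs_lt_between in Hy.
unfold log_u, log_v.
rewrite (Cmult_comm Ci t).
unfold Cminus; rewrite !im_plus, im_opp, im_scal_l, im_mult.
unfold Ci; simpl Re; simpl Im.
split; apply Rabs_lt_between; unfold Re, Im in *; simpl in *; lra.
Qed.

Lemma log_u_shift (y t theta : C) : (log_u y (t + theta) = log_u y t - Ci * theta)%C.
Proof. unfold log_u; ring. Qed.

Lemma log_v_shift (y t theta : C) : (log_v y (t + theta) = log_v y t + Ci * theta)%C.
Proof. unfold log_v; ring. Qed.

Lemma box_u_polar (theta y t : C) :
  box_u theta (polar y (t + theta)%C) = Cexp (log_u y t).
Proof.
unfold box_u; rewrite coord_u_polar, log_u_shift.
transitivity (- (Ci * Ci) * (Cexp (Ci * theta) * Cexp (log_u y t - Ci * theta)))%C; [ring|].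
rewrite <- Cexp_plus, Ci2.
replace (Ci * theta + (log_u y t - Ci * theta))%C with (log_u y t) by ring; ring.
Qed.

Lemma box_v_polar (theta y t : C) :
  box_v theta (polar y (t + theta)%C) = Cexp (log_v y t).
Proof.
unfold box_v; rewrite coord_v_polar, log_v_shift.
transitivity (- (Ci * Ci) * (Cexp (- (Ci * theta)) * Cexp (log_v y t + Ci * theta)))%C; [ring|].
rewrite <- Cexp_plus, Ci2.
replace (- (Ci * theta) + (log_v y t + Ci * theta))%C with (log_v y t) by ring; ring.
Qed.

Lemma box_map_inv (theta : C) (q : C2) : in_box q ->
  box_dom theta (box_inv theta q) /\ box_map theta (box_inv theta q) = q.
Proof.
intros Hq.
pose proof (Re_box_y q Hq) as Hy.
destruct (Im_log_u (box_y q) (fst q)) as [Ia Ib]; [apply open_disc_0, Hq|].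
assert (E : box_map theta (box_inv theta q) = q).
{ unfold box_map, box_inv.
  rewrite box_u_polar, box_v_polar, !Clog_Cexp by assumption.
  rewrite log_u_plus_log_v.
  replace (- - Clog (box_y q))%C with (Clog (box_y q)) by ring.
  rewrite Cexp_Clog by assumption.
  destruct q as [t H]; unfold fst, snd.
  replace (log_u (box_y (t, H)) t - log_v (box_y (t, H)) t)%C with (- Ci * (2 * t))%C
    by (unfold log_u, log_v; ring).
  replace (Ci * (- Ci * (2 * t)))%C with (2 * t)%C by ring [Ci2].
  f_equal.
  - rewrite RtoC_inv by lra; field.
  - unfold box_y, fst, snd; rewrite Cexp_opp; field; apply Cexp_neq_0. }
split; [|exact E].
split; [|now rewrite E].
unfold box_inv; rewrite box_u_polar, box_v_polar.
split; now apply Re_Cexp_pos.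
Qed.

Lemma box_inv_map (theta : C) (p : C2) : box_dom theta p ->
  in_box (box_map theta p) /\ box_inv theta (box_map theta p) = p.
Proof.
intros [[Hu Hv] Hq]; split; [exact Hq|].
pose proof (Re_box_y _ Hq) as Hy.
pose proof (Im_Clog (box_u theta p)) as Ia.
pose proof (Im_Clog (box_v theta p)) as Ib.
pose proof (Cexp_Clog _ Hu) as Ea.
pose proof (Cexp_Clog _ Hv) as Eb.
set (a := Clog (box_u theta p)) in *; set (b := Clog (box_v theta p)) in *.
assert (Ey : box_y (box_map theta p) = Cexp (- (a + b))).
{ unfold box_y, box_map; fold a b; unfold fst, snd.
  replace (2 * (RtoC (/ 2) * (Ci * (a - b))))%C with (Ci * (a - b))%C
    by (rewrite RtoC_inv by lra; field).
  rewrite (Cexp_opp (Ci * (a - b))); field; apply Cexp_neq_0. }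
(* Each of [a] and [b] has imaginary part below [PI / 2], so their sum is only known to be below
   [PI]; [Re y > 0] selects the principal branch. *)
assert (El : Clog (box_y (box_map theta p)) = (- (a + b))%C).
{ rewrite Ey; apply Clog_Cexp, Im_lt_of_Re_Cexp_pos; [|now rewrite <- Ey].
  rewrite im_opp, im_plus.
  apply Rabs_lt_between in Ia; apply Rabs_lt_between in Ib.
  apply Rabs_lt_between; lra. }
assert (Et : fst (box_map theta p) = (RtoC (/ 2) * (Ci * (a - b)))%C) by reflexivity.
unfold box_inv, polar; rewrite log_u_shift, log_v_shift.
assert (La : log_u (box_y (box_map theta p)) (fst (box_map theta p)) = a).
{ unfold log_u; rewrite El, Et, RtoC_opp.
  transitivity ((RtoC (/2) + RtoC (/2)) * a)%C; [ring [Ci2]|rewrite half_half; ring]. }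
assert (Lb : log_v (box_y (box_map theta p)) (fst (box_map theta p)) = b).
{ unfold log_v; rewrite El, Et, RtoC_opp.
  transitivity ((RtoC (/2) + RtoC (/2)) * b)%C; [ring [Ci2]|rewrite half_half; ring]. }
rewrite La, Lb.
unfold Cminus; rewrite !Cexp_plus, Ea, Eb.
rewrite <- (of_uv_coords p) at 3; unfold box_u, box_v.
rewrite Cexp_opp.
pose proof (Cexp_neq_0 (Ci * theta)) as Hn.
f_equal.
- transitivity (- (Ci * Ci) * coord_u p * (Cexp (Ci * theta) * / Cexp (Ci * theta)))%C; [ring|].
  rewrite Ci2, Cinv_r by assumption; ring.
- transitivity (- (Ci * Ci) * coord_v p * (Cexp (Ci * theta) * / Cexp (Ci * theta)))%C; [ring|].
  rewrite Ci2, Cinv_r by assumption; ring.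
Qed.

Lemma holomorphic_at_box_u (theta : C) (p : C2) : holomorphic_at (box_u theta) p.
Proof.
apply holomorphic_at_scal_l, holomorphic_at_plus; [apply holomorphic_at_fst|].
apply holomorphic_at_scal_l, holomorphic_at_snd.
Qed.

Lemma holomorphic_at_box_v (theta : C) (p : C2) : holomorphic_at (box_v theta) p.
Proof.
apply holomorphic_at_scal_l, holomorphic_at_minus; [apply holomorphic_at_fst|].
apply holomorphic_at_scal_l, holomorphic_at_snd.
Qed.

Lemma holomorphic_at_Cexp (f : C2 -> C) (p : C2) :
  holomorphic_at f p -> holomorphic_at (fun q => Cexp (f q)) p.
Proof. intros H; eapply holomorphic_at_comp; [apply is_derive_Cexp|exact H]. Qed.

Lemma holomorphic_at_Clog (f : C2 -> C) (p : C2) :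
  0 < Re (f p) -> holomorphic_at f p -> holomorphic_at (fun q => Clog (f q)) p.
Proof. intros Hp H; eapply holomorphic_at_comp; [now apply is_derive_Clog|exact H]. Qed.

Lemma holomorphic_at_opp (f : C2 -> C) (p : C2) :
  holomorphic_at f p -> holomorphic_at (fun q => - f q)%C p.
Proof.
exact (@ex_filterdiff_opp_fct C_AbsRing C2_normed C_normed _
         (@filter_filter _ _ (@locally_filter C2_normed p)) f).
Qed.

Lemma holomorphic_at_box_map (theta : C) (p : C2) :
  0 < Re (box_u theta p) -> 0 < Re (box_v theta p) ->
  holomorphic_at (fun q => fst (box_map theta q)) p /\
  holomorphic_at (fun q => snd (box_map theta q)) p.
Proof.
intros Hu Hv.
assert (Ha := holomorphic_at_Clog _ p Hu (holomorphic_at_box_u theta p)).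
assert (Hb := holomorphic_at_Clog _ p Hv (holomorphic_at_box_v theta p)).
assert (Hd := holomorphic_at_scal_l Ci _ p (holomorphic_at_minus _ _ p Ha Hb)).
split.
- now apply holomorphic_at_scal_l.
- apply holomorphic_at_mult; [|now apply holomorphic_at_Cexp].
  apply holomorphic_at_minus; [apply holomorphic_at_const|].
  now apply holomorphic_at_Cexp, holomorphic_at_opp, holomorphic_at_plus.
Qed.

Lemma holomorphic_at_of_uv (u v : C2 -> C) (p : C2) :
  holomorphic_at u p -> holomorphic_at v p ->
  @ex_filterdiff C_AbsRing C2_normed C2_normed (fun q => of_uv (u q) (v q))
    (@locally C2_normed p).
Proof.
intros Hu Hv; apply holomorphic_at_pair; apply holomorphic_at_scal_l.
- now apply holomorphic_at_plus.
- now apply holomorphic_at_scal_l, holomorphic_at_minus.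
Qed.

Lemma holomorphic_box_inv (theta : C) : holomorphic2 in_box (box_inv theta).
Proof.
intros q Hq; pose proof (Re_box_y q Hq) as Hy.
assert (Hyh : holomorphic_at box_y q).
{ apply holomorphic_at_minus; [apply holomorphic_at_const|].
  apply holomorphic_at_mult; [apply holomorphic_at_snd|].
  apply holomorphic_at_Cexp, holomorphic_at_opp, holomorphic_at_scal_l, holomorphic_at_fst. }
assert (Hl := holomorphic_at_scal_l (RtoC (- / 2)) _ q (holomorphic_at_Clog _ q Hy Hyh)).
assert (Ht := holomorphic_at_scal_l Ci _ q
  (holomorphic_at_plus _ _ q (holomorphic_at_fst q) (holomorphic_at_const theta q))).
apply holomorphic_at_of_uv; apply holomorphic_at_scal_l, holomorphic_at_Cexp.
- now apply holomorphic_at_minus.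
- now apply holomorphic_at_plus.
Qed.

Lemma biholomorphic_box_chart (theta : C) : biholomorphic_chart (box_chart theta).
Proof.
split; [simpl; lra|split; [apply exp_pos|split; [|split; [|split; [|split]]]]].
- intros p [[Hu Hv] [Ht HH]].
  destruct (holomorphic_at_box_map theta p Hu Hv) as [H1 H2].
  repeat apply filter_and.
  + apply locally_Re_pos; [apply holomorphic_at_box_u|exact Hu].
  + apply locally_Re_pos; [apply holomorphic_at_box_v|exact Hv].
  + now apply locally_open_disc.
  + now apply locally_open_disc.
- intros p [[Hu Hv] _].
  destruct (holomorphic_at_box_map theta p Hu Hv) as [H1 H2].
  exact (holomorphic_at_pair _ _ p H1 H2).
- exact (holomorphic_box_inv theta).
- exact (box_inv_map theta).
- exact (box_map_inv theta).
Qed.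

(** For fixed [b] the function [y = 1 - b e^(-2t)] solves [y' = 2 (1 - y)], so every plaque is a
    solution parametrized by time. *)
Lemma foliation_chart_box_chart (theta : C) : foliation_chart limit_field (box_chart theta).
Proof.
apply foliation_chart_flow_box.
- apply limit_field_locally_Lipschitz.
- apply biholomorphic_box_chart.
- intros p Hp; rewrite <- (proj2 (box_inv_map theta p Hp)); apply polar_nonsingular.
- intros b Hb t Ht.
  apply (solution_polar (fun s => box_y (s, b)) (fun s => s + theta)%C t).
  + assert (H1 := is_Cderive_opp _ _ _ (is_Cderive_scal_l 2%C _ _ _ (is_Cderive_id t))).
    assert (H2 := is_Cderive_comp Cexp _ _ _ _ (is_derive_Cexp _) H1).
    assert (H3 := is_Cderive_minus _ _ _ _ _ (is_Cderive_const 1%C t)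
                    (is_Cderive_scal_l b _ _ _ H2)).
    refine (is_Cderive_val _ _ _ _ H3 _); unfold box_y, fst, snd; ring.
  + eapply is_Cderive_val;
      [apply is_Cderive_plus; [apply is_Cderive_id|apply is_Cderive_const]|ring].
  + apply Re_box_y; now split.
Qed.

(** * The limit curve is a leaf *)

Lemma limit_curve_uv (p : C2) : limit_curve p <-> (coord_u p * coord_v p = - (1))%C.
Proof.
unfold limit_curve; rewrite <- coord_u_v; split; intros H.
- transitivity ((coord_u p * coord_v p + 1) - 1)%C; [ring|rewrite H; ring].
- rewrite H; ring.
Qed.

Lemma Re_1_pos : 0 < Re 1.
Proof. rewrite re_RtoC; lra. Qed.

Lemma limit_curve_polar (t : C) : limit_curve (polar 1 t).
Proof.
apply limit_curve_uv; rewrite coord_u_v_polar by exact Re_1_pos; field.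
Qed.

Lemma solution_limit_curve (t : C) : is_Cderive2 (polar 1) t (limit_field (polar 1 t)).
Proof.
apply (solution_polar (fun _ => RtoC 1) (fun s => s)).
- eapply is_Cderive_val; [apply is_Cderive_const|ring].
- apply is_Cderive_id.
- exact Re_1_pos.
Qed.

Lemma Clog_1 : Clog 1 = 0.
Proof.
rewrite <- Cexp_0; apply Clog_Cexp.
rewrite im_RtoC, Rabs_R0; pose proof PI2_1; lra.
Qed.

(** The whole curve is one trajectory defined for all complex times: writing [u = i e^c], the
    equation [uv = -1] forces [v = i e^(-c)], which is the point at time [t = i c]. *)
Lemma limit_curve_param (p : C2) : limit_curve p <-> exists t : C, polar 1 t = p.
Proof.
split; [|intros [t <-]; apply limit_curve_polar].
intros H; apply limit_curve_uv in H.
assert (Hu : coord_u p <> 0).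
{ intros E; rewrite E, Cmult_0_l in H; apply (f_equal fst) in H; simpl in H; lra. }
destruct (Cexp_surj (- Ci * coord_u p)%C) as [c Hc].
{ apply Cmult_neq_0; [|exact Hu].
  intros E; apply (f_equal snd) in E; simpl in E; lra. }
exists (Ci * c)%C; unfold polar, log_u, log_v; rewrite Clog_1.
replace (RtoC (- / 2) * 0 - Ci * (Ci * c))%C with c by ring [Ci2].
replace (RtoC (- / 2) * 0 + Ci * (Ci * c))%C with (- c)%C by ring [Ci2].
rewrite Cexp_opp, Hc; transitivity (of_uv (coord_u p) (coord_v p)); [f_equal|apply of_uv_coords].
- ring [Ci2].
- transitivity (- (1) / coord_u p)%C.
  + field; split; [exact Hu|apply Ci_nz].
  + rewrite <- H; field; exact Hu.
Qed.

(** The curve is connected as the image of all of C under a solution, and closed as a zero set: near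
    a point where [uv + 1] is nonzero, that function varies by less than its modulus. *)
Lemma leaf_limit_curve : leaf limit_field limit_curve.
Proof.
apply leaf_of_closed_integral_curve.
- apply limit_field_locally_Lipschitz.
- assert (E : limit_curve = fun p => exists t : C, True /\ polar 1 t = p).
  { apply functional_extensionality; intros p; apply propositional_extensionality.
    rewrite limit_curve_param; split; intros [t Ht]; exists t; tauto. }
  rewrite E; apply integral_curve_image.
  + apply limit_field_locally_Lipschitz.
  + intros t _; exists 1; split; [lra|trivial].
  + intros t s x _ _ _; trivial.
  + now exists (RtoC 0).
  + intros t _; apply solution_limit_curve.
  + intros t _; apply polar_nonsingular.
- intros p Hp.
  set (f := fun q => (coord_u q * coord_v q + 1)%C).
  assert (Hf : holomorphic_at f p).
  { apply holomorphic_at_plus; [|apply holomorphic_at_const].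
    apply holomorphic_at_mult.
    - apply holomorphic_at_plus; [apply holomorphic_at_fst|].
      apply holomorphic_at_scal_l, holomorphic_at_snd.
    - apply holomorphic_at_minus; [apply holomorphic_at_fst|].
      apply holomorphic_at_scal_l, holomorphic_at_snd. }
  assert (Hfp : f p <> 0) by (unfold f; rewrite coord_u_v; exact Hp).
  destruct (holomorphic_at_near f p (Cmod (f p)) Hf (proj1 (Cmod_gt_0 _) Hfp))
    as [[r Hr] Hnear].
  exists r; split; [exact Hr|]; intros q Hq HLq.
  specialize (Hnear q Hq).
  replace (f q) with (RtoC 0) in Hnear
    by (unfold f; rewrite coord_u_v; symmetry; exact HLq).
  replace (0 - f p)%C with (- f p)%C in Hnear by ring.
  rewrite Cmod_opp in Hnear; lra.
Qed.

(** * Transversal sections, the loop and its holonomy *)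

Definition polar_section (theta : C) : section :=
  LocalSection (fun s => polar (1 - s) theta) (exp (- 2)).

(** The identity behind the holonomy: in the chart based at [theta], the point with parameter [s] at
    relative time [t] has first integral [s e^(2t)]. At [t = 0] the section parameter is the first
    integral itself, so the section is the slice of the chart at time 0. *)
Lemma polar_box_inv (theta t s : C) :
  polar (1 - s) (t + theta) = box_inv theta (t, s * Cexp (2 * t))%C.
Proof.
unfold box_inv, box_y, fst, snd; do 2 f_equal.
rewrite Cexp_opp; field; apply Cexp_neq_0.
Qed.

Lemma polar_section_box_inv (theta s : C) :
  sec_map (polar_section theta) s = box_inv theta (RtoC 0, s).
Proof.
simpl; rewrite <- (Cplus_0_l theta) at 1; rewrite polar_box_inv.
rewrite Cmult_0_r, Cexp_0, Cmult_1_r; reflexivity.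
Qed.

Lemma in_box_0 (s : C) : open_disc 0 (exp (- 2)) s -> in_box (RtoC 0, s).
Proof. intros H; split; [apply open_disc_center; lra|exact H]. Qed.

Lemma transversal_polar_section (theta : C) :
  transversal_section limit_field (polar_section theta) (polar 1 theta).
Proof.
split; [apply exp_pos|split; [simpl; f_equal; ring|split]].
- intros s s' Hs Hs' E.
  rewrite !polar_section_box_inv in E.
  assert (E2 : (RtoC 0, s) = (RtoC 0, s')).
  { rewrite <- (proj2 (box_map_inv theta _ (in_box_0 s Hs))), E.
    apply box_map_inv, in_box_0, Hs'. }
  now injection E2.
- intros s Hs.
  assert (Hy : 0 < Re (1 - s)%C).
  { pose proof (Re_box_y _ (in_box_0 s Hs)) as H.
    unfold box_y, fst, snd in H.
    replace (- (2 * 0))%C with (RtoC 0) in H by ring.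
    now rewrite Cexp_0, Cmult_1_r in H. }
  assert (H := is_derive_polar (fun s => 1 - s)%C (fun _ => theta) s _ _
     (is_Cderive_minus _ _ _ _ _ (is_Cderive_const 1%C s) (is_Cderive_id s))
     (is_Cderive_const theta s) Hy).
  cbv zeta in H; eexists; split; [exact H|].
  simpl sec_map; pose proof (coord_u_v_polar _ theta Hy) as Euv.
  rewrite coord_u_v in Euv.
  destruct (polar (1 - s) theta) as [z w].
  pose proof (neq_0_of_Re_pos _ Hy) as Hn.
  unfold limit_field, vector_field; cbn [fst snd] in Euv |- *.
  (* The tangent is the position divided by [2 (1 - s)], so its determinant with the field is
     [- (z^2 + w^2) / (2 (1 - s))], and [z^2 + w^2 = - 1 / (1 - s)]. *)
  match goal with |- ?x <> _ =>
    replace x with (RtoC (/ 2) * / ((1 - s) * (1 - s)))%C end.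
  + apply Cmult_neq_0.
    * intros E; apply RtoC_inj in E; lra.
    * intros E; apply C1_nz.
      rewrite <- (Cinv_r ((1 - s) * (1 - s))%C), E by (now apply Cmult_neq_0); ring.
  + rewrite RtoC_opp.
    transitivity (RtoC (/ 2) * / (1 - s) * - (z ^ 2 + w ^ 2))%C.
    * rewrite Euv; simpl Cpow. field; exact Hn.
    * simpl Cpow. field; exact Hn.
Qed.

Definition limit_loop (x : R) : C2 := polar 1 (RtoC (2 * PI * x)).

Lemma continuous_limit_loop (x : R) : @continuous R_UniformSpace C2_normed limit_loop x.
Proof.
intros P [[eps He] HP].
destruct (is_Cderive2_continuous_eps _ _ _ eps
            (solution_limit_curve (RtoC (2 * PI * x))) He) as [d [Hd Hc]].
pose proof PI_RGT_0.
assert (Hd' : 0 < d / (2 * PI)) by (apply Rdiv_lt_0_compat; lra).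
exists (mkposreal _ Hd'); intros y Hy; apply HP.
apply Hc; rewrite <- RtoC_minus, Cmod_R.
replace (2 * PI * y - 2 * PI * x) with (2 * PI * (y - x)) by ring.
rewrite Rabs_mult, Rabs_pos_eq by lra.
assert (Hy' : Rabs (y - x) < d / (2 * PI)) by exact Hy.
apply Rlt_le_trans with (2 * PI * (d / (2 * PI))).
- apply Rmult_lt_compat_l; lra.
- right; field; lra.
Qed.

(** Stated for every [y], so that the sections at times 0 and [2 PI] coincide as maps and not only
    at their base points, as [holonomy] demands. *)
Lemma polar_period (y : C) : polar y (RtoC (2 * PI)) = polar y 0.
Proof.
assert (E : Cexp (Ci * RtoC (2 * PI)) = 1%C).
{ unfold Cexp; simpl.
  replace (0 * (2 * PI) - 1 * 0) with 0 by ring.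
  replace (0 * 0 + 1 * (2 * PI)) with (2 * PI) by ring.
  rewrite exp_0, cos_2PI, sin_2PI; unfold RtoC; f_equal; ring. }
rewrite <- (Cplus_0_l (RtoC (2 * PI))).
unfold polar; rewrite log_u_shift, log_v_shift.
unfold Cminus; rewrite !Cexp_plus, Cexp_opp, E; f_equal; field.
Qed.

Lemma closed_limit_loop : closed_curve limit_curve (polar 1 0) limit_loop.
Proof.
split; [|split; [|split]].
- intros x _; apply (filterlim_filter_le_1 _ (filter_le_within _)).
  apply continuous_limit_loop.
- intros x _; apply limit_curve_polar.
- unfold limit_loop; now rewrite Rmult_0_r.
- unfold limit_loop; rewrite Rmult_1_r; apply polar_period.
Qed.

Lemma same_plaque_box (theta t1 t2 s : C) :
  in_box (t1, s) -> in_box (t2, s) ->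
  same_plaque (box_chart theta) (box_inv theta (t1, s)) (box_inv theta (t2, s)).
Proof.
intros H1 H2.
destruct (box_map_inv theta _ H1) as [D1 E1], (box_map_inv theta _ H2) as [D2 E2].
split; [exact D1|split; [exact D2|]].
unfold chart_map, box_chart; now rewrite E1, E2.
Qed.

(** In the chart at [theta] the target section sits at relative time [delta], so equality of first
    integrals reads [s = g(s) e^(2 delta)]. Since [delta] is nonnegative the factor is at most 1,
    and the image stays in the section disc. *)
Lemma plaque_transport_box (theta : C) (delta : R) :
  0 <= delta < / 2 ->
  plaque_transport (box_chart theta) (polar_section theta)
    (polar_section (RtoC delta + theta)) (fun s => RtoC (exp (- (2 * delta))) * s)%C.
Proof.
intros Hd; split; [ring|].
exists (exp (- 2)); split; [apply exp_pos|].
intros s Hs.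
set (q := exp (- (2 * delta))).
assert (Hq : 0 < q <= 1).
{ split; [apply exp_pos|]; unfold q; rewrite <- exp_0.
  destruct (Req_dec delta 0) as [->|Hn].
  - right; f_equal; ring.
  - left; apply exp_increasing; lra. }
split; [|split; [exact Hs|split]].
- exists (RtoC q * 1)%C; apply is_Cderive_scal_l, is_Cderive_id.
- unfold open_disc; simpl sec_radius; apply open_disc_0 in Hs.
  replace (RtoC q * s - 0)%C with (RtoC q * s)%C by ring.
  rewrite Cmod_mult, Cmod_R, Rabs_pos_eq by lra.
  pose proof (Cmod_ge_0 s); nra.
- rewrite polar_section_box_inv; simpl sec_map.
  rewrite polar_box_inv.
  replace (RtoC q * s * Cexp (2 * RtoC delta))%C with s.
  + apply same_plaque_box; [now apply in_box_0|split; [|exact Hs]].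
    simpl; unfold open_disc.
    replace (RtoC delta - 0)%C with (RtoC delta) by ring.
    rewrite Cmod_R, Rabs_pos_eq; lra.
  + assert (E : Cexp (2 * RtoC delta) = RtoC (exp (2 * delta))).
    { unfold Cexp, RtoC; simpl.
      replace (2 * 0 + 0 * delta) with 0 by ring.
      replace (2 * delta - 0 * 0) with (2 * delta) by ring.
      rewrite cos_0, sin_0; f_equal; ring. }
    assert (E2 : q * exp (2 * delta) = 1).
    { unfold q; rewrite <- exp_plus, <- exp_0; f_equal; ring. }
    rewrite E; transitivity ((q * exp (2 * delta))%R * s)%C.
    * rewrite E2; ring.
    * rewrite RtoC_mult; ring.
Qed.

Lemma compose_upto_scal (k : C) (n : nat) (s : C) :
  compose_upto (fun _ s => (k * s)%C) n s = (k ^ n * s)%C.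
Proof. induction n as [|n IH]; simpl; [ring|rewrite IH; ring]. Qed.

(* The charts have time radius 1/2, so 17 > 4 PI equal steps, of time
   2 PI / 17 < 1/2 each, suffice. *)
Lemma holonomy_limit_loop :
  holonomy limit_field limit_loop (polar_section 0)
    (fun s => RtoC (exp (- (2 * (2 * PI / 17)))) ^ 17 * s)%C.
Proof.
set (delta := 2 * PI / 17).
pose proof PI_RGT_0; pose proof PI_4.
(* Only the crude bound [PI <= 4] is used, which gives [delta <= 8 / 17]. *)
assert (Hdelta : 0 <= delta < / 2) by (unfold delta; lra).
set (tau := fun i : nat => INR i / 17).
set (theta := fun i : nat => RtoC (2 * PI * tau i)).
exists 17%nat, tau, (fun i => box_chart (theta i)), (fun i => polar_section (theta i)),
  (fun _ s => RtoC (exp (- (2 * delta))) * s)%C.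
assert (T17 : tau 17%nat = 1) by (unfold tau; simpl; field).
assert (T0 : tau O = 0) by (unfold tau; simpl; field).
assert (TS : forall i, tau (Datatypes.S i) = tau i + / 17)
  by (intros i; unfold tau; rewrite S_INR; field).
split; [exact T0|split; [exact T17|split; [|split; [|split; [|split]]]]].
- unfold theta; now rewrite T0, Rmult_0_r.
- unfold theta; rewrite T17, Rmult_1_r; unfold polar_section; f_equal.
  apply functional_extensionality; intros s; apply polar_period.
- intros i _; apply transversal_polar_section.
- intros i _; split; [rewrite TS; lra|split; [apply foliation_chart_box_chart|split]].
  (* On this piece the loop runs along the plaque with first integral 0, at real relative times from
     0 to [delta]. *)
  + assert (G : forall u, tau i <= u <= tau (Datatypes.S i) ->
      limit_loop u = box_inv (theta i) (RtoC (2 * PI * (u - tau i)), RtoC 0) /\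
      in_box (RtoC (2 * PI * (u - tau i)), RtoC 0)).
    { intros u Hu; rewrite TS in Hu; split.
      - rewrite <- (Cmult_0_l (Cexp (2 * RtoC (2 * PI * (u - tau i))))).
        rewrite <- polar_box_inv; unfold limit_loop, theta; f_equal.
        + ring.
        + rewrite <- RtoC_plus; f_equal; ring.
      - split; [|apply open_disc_center, exp_pos].
        unfold open_disc, fst.
        replace (RtoC (2 * PI * (u - tau i)) - 0)%C
          with (RtoC (2 * PI * (u - tau i))) by ring.
        rewrite Cmod_R, Rabs_pos_eq; unfold delta in Hdelta; nra. }
    intros u Hu.
    destruct (G (tau i)) as [-> B1]; [rewrite TS; lra|].
    destruct (G u Hu) as [-> B2].
    now apply same_plaque_box.
  + replace (theta (Datatypes.S i)) with (RtoC delta + theta i)%C.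
    * now apply plaque_transport_box.
    * unfold theta; rewrite TS, <- RtoC_plus; f_equal; unfold delta; field.
- exists 1; split; [lra|]; intros s _; symmetry; apply compose_upto_scal.
Qed.

Theorem mainTheorem1 :
  let X := vector_field
             (fun z w : C => w + z * (z ^ 2 + w ^ 2 + 1))%C
             (fun z w : C => - z + w * (z ^ 2 + w ^ 2 + 1))%C in
  let L := fun p : C2 => (fst p ^ 2 + snd p ^ 2 + 1)%C = RtoC 0 in
  complex_limit_cycle X L /\ ~ (exists p : C2, L p /\ real_plane p).
Proof.
intros X L; change X with limit_field; change L with limit_curve.
split; [split; [exact leaf_limit_curve|]|].
- exists (polar 1 0), (polar_section 0).
  exists (fun s => RtoC (exp (- (2 * (2 * PI / 17)))) ^ 17 * s)%C.
  split; [apply limit_curve_polar|split; [apply transversal_polar_section|split]].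
  + exists limit_loop; split; [apply closed_limit_loop|apply holonomy_limit_loop].
  + intros [e [He Heq]].
    pose proof PI_RGT_0.
    set (q := exp (- (2 * (2 * PI / 17)))) in *.
    assert (Hq : 0 <= q < 1).
    { split; [left; apply exp_pos|]; unfold q; rewrite <- exp_0.
      apply exp_increasing; lra. }
    (* The germs are compared at one nonzero real point, where equality would force [q ^ 17 = 1],
       although [q < 1]. *)
    assert (Hs : open_disc 0 e (RtoC (e / 2))).
    { unfold open_disc; replace (RtoC (e / 2) - 0)%C with (RtoC (e / 2)) by ring.
      rewrite Cmod_R, Rabs_pos_eq; lra. }
    specialize (Heq _ Hs); cbv beta in Heq.
    rewrite <- RtoC_pow, <- RtoC_mult in Heq; apply RtoC_inj in Heq.
    destruct (pow_lt_1_compat q 17 Hq ltac:(lia)); nra.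
- intros [[[z z'] [w w']] [HL [Hz Hw]]].
  unfold Im in Hz, Hw; simpl in Hz, Hw; subst z' w'.
  apply (f_equal fst) in HL; simpl in HL; nra.
Qed.
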